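(* Let $S$ be a compact oriented surface, possibly with boundary, let $T$ be a finite semi-simplicial triangulation of $S$, let $\Delta: E(T) \to (0,\pi]$ be a function on the edges of $T$, and let $H_d: \pi_1(S \setminus V(T)) \to \mathbb{R}$ be a representation. Then there exists a (singular) similarity structure on $S$ with dilatational holonomy $H_d$ and cone points contained in $V(T)$, whose Delaunay triangulation is combinatorially equivalent to $T$ and has dihedral angles given by $\Delta$, if and only if the following two conditions hold: (1) $\Delta(e) > 0$ for all $e \in E(T)$; (2) for every set of faces $\mathcal{F} \subseteq F(T)$, writing $E(\mathcal{F})$ for the set of edges incident to some face in $\mathcal{F}$, $$\sum_{e \in E(\mathcal{F})} \Delta(e) \ge \pi |\mathcal{F}|,$$ with equality if and only if $\mathcal{F} = F(T)$ or $E(\mathcal{F}) = \emptyset$.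
   Context: A semi-simplicial triangulation is one in which distinct closed cells may intersect in a collection of lower-dimensional cells; $V(T),E(T),F(T)$ are its vertices, edges, faces. A similarity structure on $S$ with singularities in $V(T)$ is an atlas on $S \setminus V(T)$ whose transition maps are Euclidean similarities; equivalently, $S$ is assembled from Euclidean triangles glued along edges by similarities in the pattern of $T$ (if all gluings are isometries it is a singular Euclidean structure). Its holonomy is a representation of $\pi_1(S\setminus V(T))$ into the similarity group; the dilatational holonomy $H_d$ is $\gamma \mapsto \log$ of the dilatation factor of the holonomy of $\gamma$. For a geodesic triangulation with Euclidean triangular faces: if $e=AB$ is a boundary edge lying in face $ABC$, its dihedral angle is the angle of $ABC$ at $C$; if $e=AB$ is an interior edge lying in faces $ABC$ and $ABD$, its dihedral angle is the sum of the angle of $ABC$ at $C$ and the angle of $ABD$ at $D$. A triangulation is Delaunay if the dihedral angle of every interior edge is at most $\pi$.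
   Formalization: The surface S is assumed connected; for a disconnected S the equality clause of condition (2) fails for the faces of a single component even when the similarity structure exists. *)

(* Defs.v *)
From HB Require Import structures.
From mathcomp Require Import all_boot all_order all_algebra.
From mathcomp Require Import all_classical all_reals all_analysis.
Set Implicit Arguments. Unset Strict Implicit. Unset Printing Implicit Defensive.
Import Order.TTheory GRing.Theory Num.Theory.
Local Open Scope ring_scope.

(* Combinatorial model of a finite semi-simplicial triangulation T of a      *)
(* compact, connected, oriented surface (possibly with boundary).           *)
(*  - F : finType is the set of faces F(T).                                  *)
(*  - Each face f has corners 0,1,2 (in positive cyclic order) and sides     *)
(*    (f,i), i : 'I_3, side i going from corner i to corner i+1.             *)
(*  - glue : side -> option side pairs sides: glue s = Some t means side s   *)
(*    and side t are identified (an interior edge), orientation-reversingly  *)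
(*    (corner i of f ~ corner j+1 of f', corner i+1 of f ~ corner j of f');  *)
(*    glue s = None means s is a boundary edge.                              *)
(*  Gluing triangles pairwise along sides this way always yields a compact   *)
(*  oriented surface with boundary, and every such T arises like that.       *)

Definition side (F : finType) := (F * 'I_3)%type.

Definition is_gluing (F : finType) (glue : side F -> option (side F)) : Prop :=
  forall s t, glue s = Some t -> glue t = Some s /\ t <> s.

Definition face_adj (F : finType) (glue : side F -> option (side F)) : rel F :=
  fun f f' => [exists i : 'I_3, exists j : 'I_3, glue (f, i) == Some (f', j)].

Definition surface_connected (F : finType) (glue : side F -> option (side F)) : Prop :=
  forall f f' : F, connect (face_adj glue) f f'.

Definition edge_of (F : finType) (glue : side F -> option (side F)) (s : side F)
  : {set side F} :=
  match glue s with
  | Some t => [set s; t]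
  | None => [set s]
  end.

Definition edges (F : finType) (glue : side F -> option (side F)) : {set {set side F}} :=
  [set edge_of glue s | s : side F].

Definition face_edges (F : finType) (glue : side F -> option (side F)) (Fs : {set F})
  : {set {set side F}} :=
  [set edge_of glue s | s in [set s : side F | s.1 \in Fs]].

(* A walk is the sequence of sides crossed; starting in face cur, crossing     *)
(* side s (a side of cur, interior) leads to the face on the other side.       *)
Fixpoint walk_end (F : finType) (glue : side F -> option (side F)) (cur : F)
  (w : seq (side F)) : option F :=
  match w with
  | [::] => Some cur
  | s :: w' =>
      if s.1 == cur then
        match glue s with
        | Some t => walk_end glue t.1 w'
        | None => None
        end
      else None
  end.

Definition closed_walk (F : finType) (glue : side F -> option (side F)) (b : F)
  (w : seq (side F)) : Prop := walk_end glue b w = Some b.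

(* S \ V(T) deformation retracts onto the dual graph (plus contractible       *)
(* hairs to boundary edges), so pi_1(S \ V(T), b) is the group of closed       *)
(* dual walks at the base face b modulo backtracking, under concatenation.     *)
(* A representation pi_1(S \ V(T)) -> (R,+) is thus a function on closed walks *)
(* at b which is additive under concatenation and invariant under insertion   *)
(* of a backtrack s, t (crossing an edge and immediately crossing back).       *)
Definition is_rep (R : realType) (F : finType) (glue : side F -> option (side F))
  (b : F) (H : seq (side F) -> R) : Prop :=
  (forall w1 w2, closed_walk glue b w1 -> closed_walk glue b w2 ->
     H (w1 ++ w2) = H w1 + H w2) /\
  (forall u v s t, glue s = Some t -> closed_walk glue b (u ++ s :: t :: v) ->
     H (u ++ s :: t :: v) = H (u ++ v)).

Definition pt (R : realType) := (R * R)%type.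
Definition vsub (R : realType) (p q : pt R) : pt R := (p.1 - q.1, p.2 - q.2).
Definition dot (R : realType) (u v : pt R) : R := u.1 * v.1 + u.2 * v.2.
Definition cross (R : realType) (u v : pt R) : R := u.1 * v.2 - u.2 * v.1.
Definition vnorm (R : realType) (u : pt R) : R := Num.sqrt (dot u u).
Definition angle_at (R : realType) (A B C : pt R) : R :=
  acos (dot (vsub B A) (vsub C A) / (vnorm (vsub B A) * vnorm (vsub C A))).

(* A similarity structure on S with singularities in V(T) having T as a      *)
(* geodesic triangulation with Euclidean faces is given by a Euclidean        *)
(* triangle for each face (tri f i = position of corner i in the chart of f), *)
(* nondegenerate and positively oriented; the gluing of sides s ~ t is the   *)
(* unique orientation preserving similarity matching endpoints as above.     *)
Definition triangles_ok (R : realType) (F : finType) (tri : F -> 'I_3 -> pt R) : Prop :=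
  forall f, 0 < cross (vsub (tri f (ordS ord0)) (tri f ord0))
                      (vsub (tri f (ordS (ordS ord0))) (tri f ord0)).

Definition side_len (R : realType) (F : finType) (tri : F -> 'I_3 -> pt R) (s : side F) : R :=
  vnorm (vsub (tri s.1 (ordS s.2)) (tri s.1 s.2)).

Definition opp_angle (R : realType) (F : finType) (tri : F -> 'I_3 -> pt R) (s : side F) : R :=
  angle_at (tri s.1 (ordS (ordS s.2))) (tri s.1 s.2) (tri s.1 (ordS s.2)).

Definition dihedral (R : realType) (F : finType) (glue : side F -> option (side F))
  (tri : F -> 'I_3 -> pt R) (s : side F) : R :=
  match glue s with
  | Some t => opp_angle tri s + opp_angle tri t
  | None => opp_angle tri s
  end.

Definition is_delaunay (R : realType) (F : finType) (glue : side F -> option (side F))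
  (tri : F -> 'I_3 -> pt R) : Prop :=
  forall s t, glue s = Some t -> dihedral glue tri s <= pi.

(* log of the dilatation factor of the transition map when crossing side s *)
Definition log_dil (R : realType) (F : finType) (glue : side F -> option (side F))
  (tri : F -> 'I_3 -> pt R) (s : side F) : R :=
  match glue s with
  | Some t => ln (side_len tri s / side_len tri t)
  | None => 0
  end.

Definition dil_hol (R : realType) (F : finType) (glue : side F -> option (side F))
  (tri : F -> 'I_3 -> pt R) (w : seq (side F)) : R :=
  \sum_(s <- w) log_dil glue tri s.

Definition has_dil_holonomy (R : realType) (F : finType) (glue : side F -> option (side F))
  (tri : F -> 'I_3 -> pt R) (b : F) (H : seq (side F) -> R) : Prop :=
  forall w, closed_walk glue b w -> dil_hol glue tri w = H w.

(* Main.v *)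
Require Import Defs.
From HB Require Import structures.
From mathcomp Require Import all_boot all_order all_algebra.
From mathcomp Require Import all_classical all_reals all_analysis.
From mathcomp Require Import ring lra.
Import Order.TTheory GRing.Theory Num.Theory.
Import numFieldNormedType.Exports.
Local Open Scope ring_scope.
Set Implicit Arguments.
Unset Strict Implicit.
Unset Printing Implicit Defensive.

(* An angle system assigns positive angles to the corners, with face sums [pi]
   and edge sums [Delta].  Triangles with these angles realise the dihedral angles;
   by the law of sines the dilatation along a closed dual walk is the sum of
   [ln sin (angle at s) - ln sin (angle at t)] over the crossings [s -> t].

   Existence.  Minimise
     [pi * \sum_f ln (\sum_(s in f) exp x_(e s)) - \sum_e Delta_e x_e].
   The strict face condition makes it coercive modulo constants, and at a minimum
   the softmax weights times [pi] form an angle system.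

   Holonomy.  Write the representation as [w |-> \sum (kappa s - kappa t)] and
   maximise [\sum_s (A (x_s) + kappa_s x_s)], where [A' = - ln sin], over the
   compact polytope of nonnegative angle systems.  If the maximum had a zero angle,
   the slope towards an interior angle system would be [+oo].  At an interior
   maximum, the derivative in the direction [\sum (1_s - 1_t)] of a closed walk
   vanishes, which is the holonomy condition. *)

(** * A primitive of - ln sin, continuous at 0 and pi *)

Section Analysis.
Local Open Scope classical_set_scope.

(** The base point lies strictly left of [x], so the derivative is two-sided. Integrating from -1
    will thus cover the endpoint 0. *)
Lemma continuous_primitive (R : realType) (f : R -> R) (a : R) :
  continuous f ->
  exists G : R -> R, forall x, a < x -> is_derive x 1 G (f x).
Proof.
move=> cf.
exists (fun y => (\int[@lebesgue_measure R]_(t in `[a, y]%classic) f t)%R) => x ax.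
have fi : (@lebesgue_measure R).-integrable `[a, x + 1]%classic (EFin \o f).
  apply: continuous_compact_integrable; first exact: segment_compact.
  exact: continuous_subspaceT.
have x1 : x < x + 1 by rewrite ltrDl.
have [dF FE] := continuous_FTC1_closed x1 fi ax (cf x).
by rewrite derive1E in FE; apply: DeriveDef.
Qed.

(** From [ln y < y] at [y = 1 / sqrt x] comes [|x ln x| <= 2 sqrt x] for [0 < x < 1]. The limit is
    two-sided because [ln] is 0 on nonpositive numbers. *)
Lemma cvg_xlnx0 (R : realType) : (fun x : R => x * ln x) x @[x --> 0] --> (0 : R).
Proof.
have sq0 : (fun x : R => 2 * Num.sqrt x) x @[x --> 0] --> (0 : R).
  have : (fun x : R => 2 * Num.sqrt x) x @[x --> 0] --> (2 * Num.sqrt 0 : R).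
    by apply: cvgMr; exact: sqrt_continuous.
  by rewrite sqrtr0 mulr0.
apply/cvgr0Pnorm_lt => e e0.
move/cvgr0Pnorm_lt : sq0 => /(_ e e0) sq0.
near=> x.
have : `|2 * Num.sqrt x| < e by near: x.
apply: le_lt_trans.
have [x0|x0] := leP x 0; first by rewrite ln0// mulr0 normr0.
have x1 : x < 1 by near: x; apply: lt_nbhsl; rewrite ltr01.
have s0 : 0 < Num.sqrt x by rewrite sqrtr_gt0.
have xE : x = Num.sqrt x * Num.sqrt x by rewrite -expr2 sqr_sqrtr ?ltW.
rewrite normrM (gtr0_norm x0) ler0_norm; last by rewrite ln_le0 ?ltW.
rewrite ger0_norm; last by rewrite mulr_ge0// ltW.
rewrite {1 2}xE lnM ?posrE//.
have := @ln_sublinear _ (Num.sqrt x)^-1.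
rewrite invr_gt0 => /(_ s0); rewrite lnV ?posrE// => h.
have : Num.sqrt x * - ln (Num.sqrt x) <= 1.
  by rewrite -ler_pdivlMl// mulr1 ltW.
nra.
Unshelve. all: by end_near. Qed.

Definition sinc (R : realType) (x : R) : R := if x == 0 then 1 else sin x / x.

Lemma continuous_sinc (R : realType) : continuous (@sinc R).
Proof.
move=> x; have [->|x0] := eqVneq x 0.
  (* Off 0, [sinc] is the difference quotient of [sin] at 0, whose limit is [cos 0 = 1]. *)
  have [d1 d2] := is_derive_sin (0 : R).
  rewrite cos0 /derive in d2; rewrite /derivable in d1.
  move/cvg_ex : d1 => [l dl].
  have l1 : l = 1 by rewrite -d2; apply/esym/cvg_lim.
  rewrite l1 in dl.
  have dl' : sinc h @[h --> (0:R)^'] --> (1 : R).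
    apply: cvg_trans dl; apply: near_eq_cvg; near=> h.
    have h0 : h != 0 by near: h; exact: nbhs_dnbhs_neq.
    by rewrite /sinc (negbTE h0) /= sin0 subr0 addr0 [h *: 1]mulr1 mulrC.
  by apply/(continuous_withinNx (@sinc R) (0 : R)); rewrite {2}/sinc eqxx.
have nx : \forall y \near x, y != 0.
  by have /cvgr_neq0 := @cvg_id _ (nbhs x); exact.
have : {for x, continuous (fun y : R => sin y / y)}.
  apply: cvgM; first exact: continuous_sin.
  exact: cvgV.
rewrite /continuous_at {2}/sinc (negbTE x0); apply: cvg_trans.
apply: near_eq_cvg; near=> y.
by rewrite /sinc ifF//; apply/negbTE; near: y.
Unshelve. all: by end_near. Qed.

Lemma sinc_gt0 (R : realType) (x : R) : 0 <= x <= pi / 2 -> 0 < sinc x.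
Proof.
move=> /andP[x0 xpi]; rewrite /sinc; case: eqVneq => [//|xn0].
have x_gt0 : 0 < x by rewrite lt_def xn0.
by rewrite divr_gt0// sin_gt0_pi// x_gt0 (le_lt_trans xpi)// ltr_pdivrMr// ltr_pMr ?pi_gt0// ltr1n.
Qed.

(* [ln (sin y) = ln y + ln (sin y / y)]: the first summand has the primitive
   [y ln y - y], and the second is continuous at [0]. *)
Lemma ln_sin_primitive_right (R : realType) : exists A : R -> R,
  (forall y, 0 <= y <= pi / 2 -> {for y, continuous A}) /\
  (forall y, 0 < y < pi / 2 -> is_derive y 1 A (- ln (sin y))).
Proof.
(* Clamping to [[0, pi / 2]] keeps [sinc] positive, so [ln (sinc (cl y))] is continuous on the whole
   line, as [continuous_primitive] requires. *)
pose cl (y : R) : R := Num.min (Num.max y 0) (pi / 2).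
have pi2 : 0 <= pi / 2 :> R by rewrite divr_ge0 ?pi_ge0.
have cl_itv y : 0 <= cl y <= pi / 2.
  by rewrite /cl le_min ge_min lexx orbT le_max lexx orbT pi2.
have cl_id y : 0 <= y <= pi / 2 -> cl y = y.
  by move=> /andP[y0 yp]; rewrite /cl max_l// min_l.
have ccl : continuous cl.
  move=> y; have c1 : {for y, continuous ((id : R -> R) \max (cst 0 : R -> R))}.
    by apply: continuous_max; [exact: cvg_id|exact: cvg_cst].
  have c2 : {for y, continuous (cst (pi / 2) : R -> R)} by exact: cvg_cst.
  exact: (continuous_min c1 c2).
have cf : continuous (fun y => - ln (sinc (cl y))).
  move=> y; apply: cvgN.
  have c1 : {for y, continuous (fun y => sinc (cl y))}.
    exact: (continuous_comp (ccl y) (@continuous_sinc R (cl y))).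
  by apply: (continuous_comp c1); apply: continuous_ln; exact: sinc_gt0.
have [G dG] := continuous_primitive (-1) cf.
have cG (y : R) : 0 <= y -> {for y, continuous G}.
  move=> y0; apply/differentiable_continuous/derivable1_diffP.
  by apply: ex_derive; apply: dG; lra.
exists (fun y => G y - (y * ln y - y)); split => y /andP[y0 yp].
  apply: cvgB; first exact: cG.
  apply: cvgB; last exact: cvg_id.
  have [->|yn0] := eqVneq y 0; first by rewrite mul0r; exact: cvg_xlnx0.
  apply: cvgM; first exact: cvg_id.
  by apply: continuous_ln; rewrite lt_def yn0.
have dGy : is_derive y 1 G (- ln (sinc (cl y))) by apply: dG; lra.
have dln := is_derive1_ln y0.
apply: is_derive_eq.
rewrite cl_id ?(ltW y0) ?(ltW yp)// /sinc (gt_eqF y0).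
have s0 : 0 < sin y by rewrite sin_gt0_pihalf// y0.
rewrite ln_div ?posrE// [ln y *: _]mulr1 [y *: _]mulfV ?gt_eqF//; ring.
Qed.

(** Write [sin y = 2 sin (y/2) cos (y/2)] with [cos (y/2) = sin ((pi - y)/2)]: both half-angles stay
    in [[0, pi / 2]], so the one-sided primitive handles both endpoints. Up to a linear term and a
    constant, [A] is the Lobachevsky function. *)
Lemma ln_sin_primitive (R : realType) : exists A : R -> R,
  (forall y, 0 <= y <= pi -> {for y, continuous A}) /\
  (forall y, 0 < y < pi -> is_derive y 1 A (- ln (sin y))).
Proof.
have [A [cA dA]] := ln_sin_primitive_right R.
have p0 := pi_gt0 R.
exists (fun y => 2 * A (2^-1 * y) - 2 * A (2^-1 * (pi - y)) - ln 2 * y).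
split => y /andP[y0 yp].
  apply: cvgB; last by apply: cvgMr; exact: cvg_id.
  apply: cvgB; apply: cvgMr.
    have c1 : {for y, continuous (fun y : R => 2^-1 * y)}.
      by apply: cvgMr; exact: cvg_id.
    by apply: (continuous_comp c1); apply: cA; lra.
  have c2 : {for y, continuous (fun y : R => 2^-1 * (pi - y))}.
    by apply: cvgMr; apply: cvgB; [exact: cvg_cst|exact: cvg_id].
  by apply: (continuous_comp c2); apply: cA; lra.
have d1 : is_derive (2^-1 * y) 1 A (- ln (sin (2^-1 * y))) by apply: dA; lra.
have d2 : is_derive (2^-1 * (pi - y)) 1 A (- ln (cos (2^-1 * y))).
  have -> : cos (2^-1 * y) = sin (2^-1 * (pi - y)).
    rewrite mulrBr [2^-1 * pi]mulrC sinB sin_pihalf cos_pihalf; ring.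
  by apply: dA; lra.
have s0 : 0 < sin (2^-1 * y) by apply: sin_gt0_pi; lra.
have c0 : 0 < cos (2^-1 * y) by apply: cos_gt0_pihalf; lra.
have -> : ln (sin y) = ln 2 + ln (sin (2^-1 * y)) + ln (cos (2^-1 * y)).
  have -> : sin y = 2 * sin (2^-1 * y) * cos (2^-1 * y).
    have {1}-> : y = (2^-1 * y) *+ 2 by rewrite -mulr_natr; field.
    by rewrite sin_mulr2n -mulr_natr; ring.
  by rewrite !lnM ?posrE ?mulr_gt0.
have e1 : is_derive y 1 (fun y : R => 2^-1 * y) 2^-1.
  by apply: is_derive_eq; rewrite /= ?scaler0 ?add0r [LHS]mulr1.
have e2 : is_derive y 1 (fun y : R => 2^-1 * (pi - y)) (- 2^-1).
  by apply: is_derive_eq; rewrite add0r mul1r [LHS]mulrN1.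
have D1 := is_derive1_comp d1 e1.
have D2 := @is_derive1_comp _ A (fun y : R => 2^-1 * (pi - y)) y _ _ d2 e2.
have D3 : is_derive y 1 (fun y : R => A (2^-1 * y)) _ := D1.
have D4 : is_derive y 1 (fun y : R => A (2^-1 * (pi - y))) _ := D2.
by apply: is_derive_eq; rewrite /= ![_ *: _]mulrC; lra.
Qed.

End Analysis.

(** * Euclidean triangles *)

Section Triangles.
Context {R : realType}.
Implicit Types A B C : pt R.

Lemma vnorm_sqr (u : pt R) : vnorm u ^+ 2 = dot u u.
Proof. by rewrite /vnorm sqr_sqrtr// /dot -!expr2 addr_ge0 ?sqr_ge0. Qed.

Lemma vnorm_sym A B : vnorm (vsub A B) = vnorm (vsub B A).
Proof. by rewrite /vnorm /dot /vsub /=; congr Num.sqrt; ring. Qed.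

Lemma dot_cross_sqr (u v : pt R) :
  dot u v ^+ 2 + cross u v ^+ 2 = dot u u * dot v v.
Proof. by rewrite /dot /cross; ring. Qed.

(** By the identity [dot_cross_sqr], dot and cross product divided by the product of norms form a
    point of the unit circle. A positive cross product puts it in the open upper half, where [acos]
    recovers the angle. *)
Lemma angle_at_cos_sin A B C :
  0 < cross (vsub B A) (vsub C A) ->
  [/\ 0 < vnorm (vsub B A) * vnorm (vsub C A), 0 < angle_at A B C < pi,
      cos (angle_at A B C) =
        dot (vsub B A) (vsub C A) / (vnorm (vsub B A) * vnorm (vsub C A)) &
      sin (angle_at A B C) =
        cross (vsub B A) (vsub C A) / (vnorm (vsub B A) * vnorm (vsub C A))].
Proof.
rewrite /angle_at; set u := vsub B A; set v := vsub C A => k0.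
have rE : (vnorm u * vnorm v) ^+ 2 = dot u v ^+ 2 + cross u v ^+ 2.
  by rewrite exprMn !vnorm_sqr dot_cross_sqr.
have r_ge0 : 0 <= vnorm u * vnorm v by rewrite mulr_ge0// sqrtr_ge0.
set r := vnorm u * vnorm v in rE r_ge0 *.
have r0 : 0 < r by rewrite lt_def r_ge0 andbT; apply/eqP => r0; nra.
have c1 : -1 < dot u v / r < 1.
  by rewrite ltr_pdivrMr// ltr_pdivlMr// mul1r mulN1r; apply/andP; split; nra.
case/andP: c1 => c1 c2.
have c12 : -1 <= dot u v / r <= 1 by rewrite !ltW.
split => //.
- by rewrite acos_gt0 ?acos_ltpi// ?c1 ?(ltW c1)// ltW.
- by rewrite acosK// in_itv.
- rewrite sin_acos// -[RHS]gtr0_norm ?divr_gt0// -sqrtr_sqr; congr Num.sqrt.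
  apply: (mulIf (x := r ^+ 2)); first by rewrite sqrf_eq0 gt_eqF.
  by rewrite mulrBl !expr_div_n !divfK ?sqrf_eq0 ?gt_eqF// mul1r rE; ring.
Qed.

(** The three corners share one cross product, and the addition formulas give [a + b] the same sine
    and cosine as [pi - c]. The positive sine forces [a + b < pi], where [cos] is injective. *)
Lemma angle_sum A B C :
  0 < cross (vsub B A) (vsub C A) ->
  angle_at A B C + angle_at B C A + angle_at C A B = pi.
Proof.
move=> k0.
have kB : cross (vsub C B) (vsub A B) = cross (vsub B A) (vsub C A).
  by rewrite /cross /vsub /=; ring.
have kC : cross (vsub A C) (vsub B C) = cross (vsub B A) (vsub C A).
  by rewrite /cross /vsub /=; ring.
have [rA tA cA sA] := angle_at_cos_sin k0.
have [|rB tB cB sB] := @angle_at_cos_sin B C A; first by rewrite kB.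
have [|rC tC cC sC] := @angle_at_cos_sin C A B; first by rewrite kC.
rewrite kB in sB; rewrite kC in sC.
move: (angle_at A B C) (angle_at B C A) (angle_at C A B) tA tB tC cA cB cC sA sB sC.
move=> a b c tA tB tC cA cB cC sA sB sC.
rewrite (vnorm_sym A B) in rB cB sB; rewrite (vnorm_sym A C) in rC cC sC.
rewrite (vnorm_sym B C) in rC cC sC.
have := vnorm_sqr (vsub B A).
move: (vnorm (vsub B A)) (vnorm (vsub C A)) (vnorm (vsub C B)) rA rB rC cA cB cC sA sB sC.
move=> p r q rA rB rC cA cB cC sA sB sC pE.
have p0 : p != 0 by apply/eqP => h; rewrite h mul0r ltxx in rA.
have q0 : q != 0 by apply/eqP => h; rewrite h mul0r ltxx in rB.
have r0 : r != 0 by apply/eqP => h; rewrite h mul0r ltxx in rC.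
have sab : sin (a + b) = sin c.
  rewrite sinD sA cA sB cB sC.
  set k := cross _ _; set d1 := dot _ _; set d2 := dot _ _.
  have e : d1 + d2 = p ^+ 2 by rewrite pE /d1 /d2 /dot /vsub /=; ring.
  transitivity (k * (d1 + d2) / (p ^+ 2 * (q * r))); first by field; rewrite p0 q0 r0.
  by rewrite e; field; rewrite p0 q0 r0.
have cab : cos (a + b) = cos (pi - c).
  rewrite [in RHS]addrC cosDpi cosN cosD sA cA sB cB cC.
  set k := cross _ _; set d1 := dot _ _; set d2 := dot _ _; set d3 := dot _ _.
  have e : d1 * d2 - k * k = - d3 * p ^+ 2.
    by rewrite pE /k /d1 /d2 /d3 /dot /cross /vsub /=; ring.
  transitivity ((d1 * d2 - k * k) / (p ^+ 2 * (q * r))); first by field; rewrite p0 q0 r0.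
  by rewrite e; field; rewrite p0 q0 r0.
have sc : 0 < sin c by apply: sin_gt0_pi.
have abpi : a + b < pi.
  rewrite ltNge; apply/negP => h.
  have : 0 <= sin (a + b - pi) by apply: sin_ge0_pi; lra.
  rewrite -[X in sin X]opprK sinN opprB addrC.
  rewrite sinDpi sinN opprK sab; lra.
suff : a + b = pi - c by lra.
by apply: cos_inj => //; rewrite in_itv /=; lra.
Qed.

Lemma ord3P (i : 'I_3) : [\/ i = ord0, i = ordS ord0 | i = ordS (ordS ord0)].
Proof.
by case: i => [[|[|[|//]]] h]; [constructor 1|constructor 2|constructor 3];
  apply: val_inj.
Qed.

Lemma ordS3 (i : 'I_3) : ordS (ordS (ordS i)) = i.
Proof. by apply: val_inj; case: i => [[|[|[|//]]] h]. Qed.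

Lemma sum_ord3 (f : 'I_3 -> R) :
  \sum_i f i = f ord0 + f (ordS ord0) + f (ordS (ordS ord0)).
Proof.
rewrite !big_ord_recl big_ord0 addr0 addrA; congr (_ + f _ + f _);
 exact: val_inj.
Qed.

(** The scale is fixed by the law of sines with circumdiameter 1, so each side length is the sine of
    its opposite angle. This is what later turns log-dilatations into differences of [ln sin]. *)
Lemma triangle_of_angles (al : 'I_3 -> R) :
  (forall i, 0 < al i) -> \sum_i al i = pi ->
  exists P : 'I_3 -> pt R,
    [/\ 0 < cross (vsub (P (ordS ord0)) (P ord0))
                  (vsub (P (ordS (ordS ord0))) (P ord0)),
        forall i, angle_at (P (ordS (ordS i))) (P i) (P (ordS i)) = al i &
        forall i, vnorm (vsub (P (ordS i)) (P i)) = sin (al i)].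
Proof.
move=> al0; rewrite sum_ord3.
have := al0 ord0; have := al0 (ordS ord0); have := al0 (ordS (ordS ord0)).
set c := al ord0; set a := al (ordS ord0); set b := al (ordS (ordS ord0)).
move=> b0 a0 c0 abc.
have sa : 0 < sin a by apply: sin_gt0_pi; lra.
have sb : 0 < sin b by apply: sin_gt0_pi; lra.
have sc : 0 < sin c by apply: sin_gt0_pi; lra.
have cE : c = - (a + b) + pi by lra.
have scE : sin c = sin a * cos b + cos a * sin b.
  by rewrite cE sinDpi sinN opprK sinD.
have ccE : cos c = sin a * sin b - cos a * cos b.
  by rewrite cE cosDpi cosN cosD; ring.
have ea := cos2Dsin2 a; have eb := cos2Dsin2 b.
(* Angle [a] sits at corner 0: corner 1 is at distance [sin c] on the axis, corner 2 at distance
   [sin b] in direction [a]. *)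
pose P (i : 'I_3) : pt R :=
  nth (0, 0) [:: (0, 0); (sin c, 0); (sin b * cos a, sin b * sin a)] i.
have n01 : vnorm (vsub (P (ordS ord0)) (P ord0)) = sin c.
  rewrite /vnorm /dot /vsub /P /= -[RHS]gtr0_norm// -sqrtr_sqr.
  by congr Num.sqrt; ring.
have n12 : vnorm (vsub (P (ordS (ordS ord0))) (P (ordS ord0))) = sin a.
  rewrite /vnorm /dot /vsub /P /= -[RHS]gtr0_norm// -sqrtr_sqr.
  congr Num.sqrt; rewrite scE -[RHS]mulr1 -eb; ring.
have n20 : vnorm (vsub (P ord0) (P (ordS (ordS ord0)))) = sin b.
  rewrite /vnorm /dot /vsub /P /= -[RHS]gtr0_norm// -sqrtr_sqr.
  congr Num.sqrt; rewrite -[RHS]mulr1 -ea; ring.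
exists P; split.
- by rewrite /cross /vsub /P /= !subr0 mul0r subr0 !mulr_gt0.
- move=> i; rewrite /angle_at.
  have [->|->|->] := ord3P i; rewrite ?ordS3.
  + rewrite n20 (vnorm_sym (P (ordS ord0))) n12 -/c.
    rewrite (_ : dot _ _ = sin b * sin a * cos c).
      by rewrite mulrC mulKf ?gt_eqF ?mulr_gt0// cosK// in_itv /=; lra.
    rewrite /dot /vsub /P /= ccE scE.
    rewrite -[RHS]mulr1 -[in LHS](mulr1 (sin b * sin a)); ring.
  + rewrite n01 (vnorm_sym (P (ordS (ordS ord0)))) n20 -/a.
    rewrite (_ : dot _ _ = sin c * sin b * cos a).
      by rewrite mulrC mulKf ?gt_eqF ?mulr_gt0// cosK// in_itv /=; lra.
    by rewrite /dot /vsub /P /=; ring.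
  + rewrite n12 (vnorm_sym (P ord0)) n01 -/b.
    rewrite (_ : dot _ _ = sin a * sin c * cos b).
      by rewrite mulrC mulKf ?gt_eqF ?mulr_gt0// cosK// in_itv /=; lra.
    by rewrite /dot /vsub /P /= scE; ring.
- by move=> i; have [->|->|->] := ord3P i; rewrite ?ordS3 ?n01 ?n12 ?n20.
Qed.

End Triangles.

(** * Extrema on boxes in finite products *)

Section FiniteProducts.
Local Open Scope classical_set_scope.

Lemma continuous_bigsum (T : topologicalType) (R : realType) (J : Type)
    (r : seq J) (P : pred J) (h : J -> T -> R) (x : T) :
  (forall j, P j -> {for x, continuous (h j)}) ->
  {for x, continuous (fun y => \sum_(j <- r | P j) h j y)}.
Proof.
move=> ch; elim: r => [|j r IH].
  rewrite (_ : (fun _ => _) = cst 0); first exact: cvg_cst.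
  by apply/funext => y; rewrite big_nil.
case: (boolP (P j)) => Pj.
  rewrite (_ : (fun _ => _) = (fun y => h j y + \sum_(j <- r | P j) h j y)).
    by apply: cvgD; [exact: ch|exact: IH].
  by apply/funext => y; rewrite big_cons Pj.
rewrite (_ : (fun _ => _) = (fun y => \sum_(j <- r | P j) h j y)); first exact: IH.
by apply/funext => y; rewrite big_cons (negbTE Pj).
Qed.

Lemma continuous_coord (R : realType) (I : finType) (i : I) :
  continuous (fun x : prod_topology (fun _ : I => R) => x i).
Proof. exact: (@proj_continuous I (fun=> R) i). Qed.

Lemma continuous_scale_coord (R : realType) (I : finType) (c : R) (i : I) :
  continuous (fun x : prod_topology (fun _ : I => R) => c * x i).
Proof.
move=> x; have h := @continuous_coord R I i x.
exact: (continuous_comp h (@mulrl_continuous R c (x i))).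
Qed.

Lemma ptws_compact (R : realType) (I : finType) (A : I -> set R) :
  (forall i, compact (A i)) ->
  compact [set x : prod_topology (fun _ : I => R) | forall i, A i (x i)].
Proof. by move=> cA; apply: tychonoff; exact: cA. Qed.

(** The box is compact by Tychonoff. Continuity is asked only inside the box because the primitive
    of [- ln sin] is controlled only on [[0, pi]]. *)
Lemma box_argmax (R : realType) (I : finType) (c : R) (P : set (prod_topology (fun _ : I => R)))
    (V : prod_topology (fun _ : I => R) -> R) :
  closed P ->
  (forall x, P x -> (forall i, 0 <= x i <= c) -> {for x, continuous V}) ->
  (exists2 x, P x & forall i, 0 <= x i <= c) ->
  exists2 x, P x /\ (forall i, 0 <= x i <= c) &
    forall y, P y -> (forall i, 0 <= y i <= c) -> V y <= V x.
Proof.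
move=> cP cV [x0 Px0 bx0].
pose B := [set x : prod_topology (fun _ : I => R) | forall i, `[0, c] (x i)].
have BE x : B x <-> forall i, 0 <= x i <= c.
  by rewrite /B /=; split => h i; have := h i; rewrite /= in_itv.
have cB : compact B.
  exact: (ptws_compact (fun i => @segment_compact _ 0 c)).
have cK : compact (P `&` B).
  by rewrite setIC; exact: compact_closedI.
have cVK : {within P `&` B, continuous V}.
  by apply: continuous_in_subspaceT => x /set_mem [Px /BE Bx]; exact: cV.
have K0 : (P `&` B) !=set0 by exists x0; split => //; exact/BE.
have [x /set_mem[Px /BE Bx] xmax] := compact_EVT_max K0 cK cVK.
exists x => // y Py By; apply: xmax; apply/mem_set; split => //; exact/BE.
Qed.

Lemma closed_linear_eq (R : realType) (I J : finType) (a : J -> I -> R) (d : J -> R) :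
  closed [set x : prod_topology (fun _ : I => R) | forall j, \sum_i a j i * x i = d j].
Proof.
rewrite (_ : mkset _ = \bigcap_(j in [set: J])
    ((fun x : prod_topology (fun _ : I => R) => \sum_i a j i * x i) @^-1` [set y | y = d j])).
  apply: closed_bigI => j _; apply: closed_comp; last exact: closed_eq.
  move=> x _; apply: continuous_bigsum => i _.
  exact: continuous_scale_coord.
by apply/seteqP; split => [x h j _|x h j]; exact: h.
Qed.

Lemma box_argmin (R : realType) (I : finType) (c : R) (V : prod_topology (fun _ : I => R) -> R) :
  0 <= c -> continuous V ->
  exists2 x, (forall i, 0 <= x i <= c) &
    forall y, (forall i, 0 <= y i <= c) -> V x <= V y.
Proof.
move=> c0 cV.
have [||x [_ bx] xmax] := @box_argmax R I c setT (fun x => - V x) closedT.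
- by move=> x _ _; have h := cV x; exact: (continuousN h).
- by exists (fun=> 0) => // i; rewrite lexx.
by exists x => // y /(xmax y Logic.I); rewrite lerN2.
Qed.

End FiniteProducts.

(** * Edge sums and the face condition *)

Section Edges.
Context {R : realType} {F : finType} (glue : side F -> option (side F)).
Hypothesis Hglue : is_gluing glue.

Lemma edge_of_self s : s \in edge_of glue s.
Proof. by rewrite /edge_of; case: (glue s) => [t|]; rewrite !inE eqxx. Qed.

Lemma edge_of_glue s t : glue s = Some t -> edge_of glue t = edge_of glue s.
Proof.
by move=> st; have [ts _] := Hglue st; rewrite /edge_of st ts finset.setUC.
Qed.

Lemma mem_edge_of s r :
  (r \in edge_of glue s) = (edge_of glue r == edge_of glue s).
Proof.
apply/idP/eqP => [|<-]; last exact: edge_of_self.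
rewrite {1}/edge_of; case E: (glue s) => [t|]; rewrite !inE.
  by case/orP => /eqP -> //; exact: edge_of_glue.
by move/eqP->.
Qed.

Lemma sum_edge (al : side F -> R) s :
  \sum_(r in edge_of glue s) al r =
  if glue s is Some t then al s + al t else al s.
Proof.
rewrite /edge_of; case E: (glue s) => [t|]; last by rewrite big_set1.
have [_ /eqP ts] := Hglue E.
by rewrite big_setU1 ?big_set1// inE eq_sym.
Qed.

Lemma sum_over_edges (Es : {set {set side F}}) (al : side F -> R) :
  Es \subset edges glue ->
  \sum_(e in Es) \sum_(r in e) al r = \sum_(s | edge_of glue s \in Es) al s.
Proof.
move=> /fintype.subsetP Esub.
rewrite [RHS](partition_big (edge_of glue) (mem Es))//=.
apply: eq_bigr => e eE; have /imsetP[s0 _ e0] := Esub _ eE.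
apply: eq_bigl => r; rewrite {1}e0 mem_edge_of -e0.
by case: eqP => [->|]; rewrite ?eE ?andbF.
Qed.

Lemma edge_of_in s : edge_of glue s \in edges glue.
Proof. exact: imset_f. Qed.

Lemma edge_of_in_face_edges (Fs : {set F}) s :
  s.1 \in Fs -> edge_of glue s \in face_edges glue Fs.
Proof. by move=> sF; apply: imset_f; rewrite inE. Qed.

Lemma face_edges_sub (Fs : {set F}) : face_edges glue Fs \subset edges glue.
Proof. by apply/fintype.subsetP => e /imsetP[s _ ->]; exact: edge_of_in. Qed.

Lemma face_edgesT : face_edges glue [set: F]%SET = edges glue.
Proof.
apply/eqP; rewrite finset.eqEsubset face_edges_sub/=; apply/fintype.subsetP => e /imsetP[s _ ->].
by apply: edge_of_in_face_edges; rewrite inE.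
Qed.

Lemma sum_sides (G : side F -> R) (Fs : {set F}) :
  \sum_(s : side F | s.1 \in Fs) G s = \sum_(f in Fs) \sum_i G (f, i).
Proof.
rewrite pair_big /= [LHS](eq_bigl (fun s : side F => (s.1 \in Fs) && true)).
  by apply: eq_bigr => -[].
by move=> s; rewrite andbT.
Qed.

(** A corner is named by its opposite side: [al (f, i)] is the angle of [f] facing side [i], so the
    sum over an edge is its dihedral angle. *)
Definition angle_system (Delta : {set side F} -> R) (al : side F -> R) :=
  [/\ forall s, 0 < al s, forall f, \sum_i al (f, i) = pi &
      forall s, \sum_(r in edge_of glue s) al r = Delta (edge_of glue s)].

(** The edge sum counts all angles of [Fs], in total [pi * #|Fs|], plus the angles of other faces
    that face an edge of [Fs]. The latter are positive, so equality means that no other face touches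
    [Fs] along an edge; connectedness does the rest. *)
Lemma angle_system_face_bound (Delta : {set side F} -> R) al (Fs : {set F}) :
  surface_connected glue -> angle_system Delta al ->
  pi * #|Fs|%:R <= \sum_(e in face_edges glue Fs) Delta e /\
  (\sum_(e in face_edges glue Fs) Delta e = pi * #|Fs|%:R <->
     Fs = [set: F]%SET \/ face_edges glue Fs = finset.set0).
Proof.
move=> Hconn [al0 alf ale].
set E := face_edges glue Fs.
have -> : \sum_(e in E) Delta e = \sum_(s | edge_of glue s \in E) al s.
  rewrite -sum_over_edges ?face_edges_sub//; apply: eq_bigr => e /imsetP[s _ ->].
  by rewrite ale.
rewrite (bigID (fun s : side F => s.1 \in Fs)) /=.
have -> : \sum_(s | (edge_of glue s \in E) && (s.1 \in Fs)) al s = pi * #|Fs|%:R.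
  rewrite (eq_bigl (fun s : side F => s.1 \in Fs)); last first.
    move=> s; apply: andb_idl; exact: edge_of_in_face_edges.
  rewrite sum_sides (eq_bigr (fun=> pi)) => [|f _]; last exact: alf.
  by rewrite sumr_const mulr_natr.
set rest := \sum_(s | _) _.
have rest0 : 0 <= rest by apply: sumr_ge0 => s _; exact: ltW.
split; first by rewrite lerDl.
split=> [h|[FsT|E0]]; last 2 first.
- by rewrite /rest big1 ?addr0// => s; rewrite FsT inE andbF.
- by rewrite /rest big1 ?addr0// => s; rewrite E0 inE.
have r0 : rest = 0 by lra.
have noout s : edge_of glue s \in E -> s.1 \in Fs.
  move=> sE; apply/negP => /negP sF.
  have a0 : al s = 0 by apply: (psumr_eq0P _ r0) => [r _|]; [exact: ltW|rewrite sE].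
  by have := al0 s; rewrite a0 ltxx.
have [Fs0|[f fF]] := set_0Vmem Fs.
  by right; rewrite /E Fs0; apply/eqP/set0Pn => -[e /imsetP[s]]; rewrite !inE.
left; apply/setP => g; rewrite inE.
have /connectP[p + ->] := Hconn f g.
elim: p f fF => [//|y p IH] x xF /= /andP[/existsP[i /existsP[j /eqP xy]] yp].
apply: IH yp; have := noout (y, j); rewrite (edge_of_glue xy); apply.
exact: edge_of_in_face_edges.
Qed.

Lemma finite_lower_bound (T : finType) (P : pred T) (g : T -> R) :
  (forall t, P t -> 0 < g t) -> exists2 d, 0 < d & forall t, P t -> d <= g t.
Proof.
(* The default [1] keeps the bound positive when nothing satisfies [P]. *)
move=> g0; exists (\big[Num.min/1]_(t | P t) g t); first exact: lt_bigmin.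
by move=> t Pt; exact: bigmin_le_cond.
Qed.

(** * Coercivity from the strict face condition *)

Section Hall.
Variable Delta : {set side F} -> R.
Hypothesis Delta_gt0 : forall e, e \in edges glue -> 0 < Delta e.
Hypothesis Delta_faces : forall Fs : {set F},
  pi * #|Fs|%:R <= \sum_(e in face_edges glue Fs) Delta e /\
  (\sum_(e in face_edges glue Fs) Delta e = pi * #|Fs|%:R <->
     Fs = [set: F]%SET \/ face_edges glue Fs = finset.set0).

Definition star (S : {set {set side F}}) : {set F} :=
  [set f | [exists i, edge_of glue (f, i) \in S]].

Lemma mem_star (S : {set {set side F}}) s : edge_of glue s \in S -> s.1 \in star S.
Proof. by move=> sS; rewrite inE; apply/existsP; exists s.2; case: s sS. Qed.

Lemma sum_Delta : \sum_(e in edges glue) Delta e = pi * #|F|%:R.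
Proof.
have [_ /iffRL] := Delta_faces [set: F]%SET.
by rewrite face_edgesT cardsT; apply; left.
Qed.

(* Apply the face condition to the faces having no edge in [S]. *)
Lemma star_gap (S : {set {set side F}}) :
  S \subset edges glue -> S != finset.set0 -> S != edges glue ->
  \sum_(e in S) Delta e < pi * #|star S|%:R.
Proof.
move=> SE S0 SnE; set Fs := ~: star S.
have cardF : #|F|%:R = #|star S|%:R + #|Fs|%:R :> R.
  by rewrite -natrD cardsC.
have ES : face_edges glue Fs \subset edges glue :\: S.
  apply/fintype.subsetP => e /imsetP[s]; rewrite inE => sF ->.
  rewrite inE edge_of_in andbT; apply/negP => /mem_star; apply/negP.
  by move: sF; rewrite inE.
have sumE : \sum_(e in edges glue) Delta e =
    \sum_(e in S) Delta e + \sum_(e in edges glue :\: S) Delta e.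
  by rewrite (big_setID S) (finset.setIidPr SE).
have sumD : \sum_(e in edges glue :\: S) Delta e =
    \sum_(e in face_edges glue Fs) Delta e +
    \sum_(e in (edges glue :\: S) :\: face_edges glue Fs) Delta e.
  by rewrite (big_setID (face_edges glue Fs)) (finset.setIidPr ES).
set rest := \sum_(e in _ :\: face_edges glue Fs) _ in sumD.
have DS0 e : e \in (edges glue :\: S) :\: face_edges glue Fs -> 0 < Delta e.
  by rewrite !inE => /and3P[_ _ /Delta_gt0].
have rest0 : 0 <= rest by apply: sumr_ge0 => e /DS0/ltW.
have [h1 [h2 _]] := Delta_faces Fs.
have tot := sum_Delta; rewrite cardF in tot.
rewrite lt_neqAle; apply/andP; split; last lra.
(* Equality would leave no edge outside both [S] and the faces [Fs], and make the face condition
   tight for [Fs]. Then [Fs] is everything, contradicting [S] nonempty, or has no edges, so that [S]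
   would contain all edges. *)
apply/eqP => eqS.
have r0 : rest = 0 by lra.
have DE : edges glue :\: S \subset face_edges glue Fs.
  apply/fintype.subsetP => e eD; apply/negP => /negP eF.
  have eDF : e \in (edges glue :\: S) :\: face_edges glue Fs by rewrite inE eF eD.
  have D0 : Delta e = 0 by apply: (psumr_eq0P _ r0) => // r /DS0/ltW.
  by have := DS0 e eDF; rewrite D0 ltxx.
case: h2; first lra.
  move=> FT; case/set0Pn: S0 => e eS.
  have /imsetP[s _ es] := fintype.subsetP SE _ eS.
  have : s.1 \in Fs by rewrite FT inE.
  by rewrite inE mem_star// -es.
move=> E0; move: DE; rewrite E0 finset.subset0 finset.setD_eq0 => DE.
by move/negP: SnE; apply; rewrite finset.eqEsubset SE.
Qed.

(* Peeling off the smallest positive value of [x] reduces the estimate to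
   [star_gap] for the set where [x] is positive. *)
Lemma coercivity : exists2 d : R, 0 < d &
  forall (x : {set side F} -> R) (M : F -> R),
  (forall e, e \in edges glue -> 0 <= x e) ->
  (exists2 e0, e0 \in edges glue & x e0 = 0) ->
  (forall s, x (edge_of glue s) <= M s.1) ->
  forall e, e \in edges glue ->
    d * x e <= pi * (\sum_f M f) - \sum_(e in edges glue) Delta e * x e.
Proof.
pose P (S : {set {set side F}}) :=
  [&& S \subset edges glue, S != finset.set0 & S != edges glue].
(* There are finitely many gaps, so one [d] bounds them all, independently of [x] and [M]. *)
have [|d d0 dgap] := @finite_lower_bound _ P
    (fun S => pi * #|star S|%:R - \sum_(e in S) Delta e).
  by move=> S /and3P[*]; rewrite subr_gt0; exact: star_gap.
exists d => // x; pose supp (x : {set side F} -> R) := [set e in edges glue | 0 < x e].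
have [n] := ubnP #|supp x|; elim: n x => // n IH x xn M x0 [e0 e0E xe0] xM e eE.
have [S0|/set0Pn[e1 e1S]] := eqVneq (supp x) finset.set0.
  have xz e' : e' \in edges glue -> x e' = 0.
    move=> e'E; apply/eqP; rewrite eq_le x0// andbT leNgt; apply/negP => h.
    by have : e' \in supp x; [rewrite inE e'E|rewrite S0 inE].
  rewrite xz// mulr0 [X in _ - X]big1 => [|e' e'E]; last by rewrite xz// mulr0.
  rewrite subr0 mulr_ge0 ?pi_ge0// sumr_ge0// => f _.
  by apply: le_trans (xM (f, ord0)); rewrite xz// edge_of_in.
set S := supp x in xn e1S.
have [em emS emin] := @arg_minP _ _ _ e1 (mem S) x e1S.
have {}emS : em \in S by exact: emS.
set m := x em in emin.
have m0 : 0 < m by move: emS; rewrite inE => /andP[].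
have PS : P S.
  apply/and3P; split.
  - by apply/fintype.subsetP => e'; rewrite inE => /andP[].
  - by apply/set0Pn; exists e1.
  - by apply: contraTN e0E => /eqP <-; rewrite inE xe0 ltxx andbF.
(* Lowering [x] by [m] on its support and [M] by [m] on the star preserves all hypotheses and
   removes [em] from the support. *)
pose x' e := if e \in S then x e - m else x e.
pose M' f := if f \in star S then M f - m else M f.
have xn' : (#|supp x'| < n)%N.
  rewrite -ltnS; apply: leq_trans xn; rewrite ltnS.
  apply: proper_card; apply/properP; split.
    apply/fintype.subsetP => e'; rewrite !inE /x' => /andP[e'E]; rewrite e'E /=.
    by case: ifP => //; rewrite inE e'E.
  exists em; first exact: emS.
  by rewrite inE /x' emS subrr ltxx andbF.
have x0' e' : e' \in edges glue -> 0 <= x' e'.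
  move=> e'E; rewrite /x'; case: ifP => e'S; last exact: x0.
  by rewrite subr_ge0; exact: emin.
have xM' s : x' (edge_of glue s) <= M' s.1.
  rewrite /x' /M'; case: ifP => sS; first by rewrite mem_star// lerD2r.
  case: ifP => sT; last exact: xM.
  move: sT; rewrite inE => /existsP[i iS].
  have -> : x (edge_of glue s) = 0.
    apply/eqP; rewrite eq_le x0 ?edge_of_in// andbT leNgt; apply/negP => h.
    by move: sS; rewrite inE edge_of_in h.
  by rewrite subr_ge0; apply: le_trans (xM (s.1, i)); exact: emin.
have ex0' : exists2 e0, e0 \in edges glue & x' e0 = 0.
  by exists e0 => //; rewrite /x' inE xe0 ltxx andbF.
have := IH x' xn' M' x0' ex0' xM' e eE.
have -> : \sum_f M' f = \sum_f M f - m * #|star S|%:R.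
  rewrite mulr_natr -sumr_const [X in _ - X]big_mkcond -sumrB.
  by apply: eq_bigr => f _; rewrite /M'; case: ifP => _; rewrite ?subr0.
have -> : \sum_(e in edges glue) Delta e * x' e =
    \sum_(e in edges glue) Delta e * x e - m * \sum_(e in S) Delta e.
  have SE : S \subset edges glue by case/and3P: PS.
  have -> : \sum_(e in S) Delta e = \sum_(e in edges glue | e \in S) Delta e.
    apply: eq_bigl => e'; apply/idP/andP => [h|[]//].
    by split=> //; exact: (fintype.subsetP SE).
  rewrite [X in _ - _ * X]big_mkcondr/= mulr_sumr -sumrB; apply: eq_bigr => e' _.
  by rewrite /x'; case: ifP => _; rewrite ?mulr0 ?subr0//; ring.
(* Peeling this layer lowers the right-hand side by [m] times the gap of [S], at least [m * d],
   while [x e] falls by at most [m]. *)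
have := dgap _ PS.
have : x e <= x' e + m by rewrite /x'; case: ifP => _; lra.
nra.
Qed.

End Hall.

End Edges.

(** * Existence of an angle system *)

(** The expression vanishes at [t = 0], so 0 is a minimum and the derivative [A - D] is zero
    there. *)
Lemma expR_tangent (R : realType) (A D : R) :
  (forall t, 0 <= A * (expR t - 1) - D * t) -> A = D.
Proof.
move=> h; pose f (t : R) := A * (expR t - 1) - D * t.
have df (t : R) : is_derive t 1 f (A * expR t - D).
  by apply: is_derive_eq; rewrite subr0 [D *: 1]mulr1.
have d0 : is_derive (0 : R) 1 f 0.
  apply: (@derive1_at_min _ f (-1) 1); rewrite ?in_itv /=; try lra.
    by move=> t _; have [] := df t.
  by move=> t _; rewrite {1}/f expR0 subrr !mulr0 subr0; exact: h.
have := @derive_val _ _ _ _ _ _ _ d0; rewrite (@derive_val _ _ _ _ _ _ _ (df 0)).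
by rewrite expR0 mulr1 => /eqP; rewrite subr_eq0 => /eqP.
Qed.

Section Scaling.
Context {R : realType} {F : finType} (glue : side F -> option (side F)).
Hypothesis Hglue : is_gluing glue.
Variable Delta : {set side F} -> R.
Hypothesis Delta_gt0 : forall e, e \in edges glue -> 0 < Delta e.
Hypothesis Delta_faces : forall Fs : {set F},
  pi * #|Fs|%:R <= \sum_(e in face_edges glue Fs) Delta e /\
  (\sum_(e in face_edges glue Fs) Delta e = pi * #|Fs|%:R <->
     Fs = [set: F]%SET \/ face_edges glue Fs = finset.set0).

Definition face_weight (x : {set side F} -> R) (f : F) : R :=
  \sum_i expR (x (edge_of glue (f, i))).

Definition scaling_potential (x : {set side F} -> R) : R :=
  pi * (\sum_f ln (face_weight x f)) - \sum_(e in edges glue) Delta e * x e.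

Lemma face_weight_gt0 x f : 0 < face_weight x f.
Proof. by rewrite /face_weight sum_ord3 !addr_gt0// expR_gt0. Qed.

(** This makes [ln (face_weight x f)] an admissible [M f] in [coercivity]. *)
Lemma ln_face_weight_ge x s : x (edge_of glue s) <= ln (face_weight x s.1).
Proof.
rewrite -[leLHS]expRK ler_ln ?posrE ?expR_gt0 ?face_weight_gt0//.
rewrite /face_weight (bigD1 s.2)//= -surjective_pairing lerDl.
by apply: sumr_ge0 => i _; exact: expR_ge0.
Qed.

Lemma continuous_scaling_potential :
  continuous (scaling_potential : prod_topology (fun _ : {set side F} => R) -> R).
Proof.
pose T := prod_topology (fun _ : {set side F} => R) : topologicalType.
move=> x.
have cw f : {for x, continuous (fun y : T => face_weight y f)}.
  apply: (@continuous_bigsum T R) => i _.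
  exact: (continuous_comp (@continuous_coord R _ (edge_of glue (f, i)) x)
            (@continuous_expR R _)).
have c1 : {for x, continuous (fun y : T => \sum_f ln (face_weight y f))}.
  apply: (@continuous_bigsum T R) => f _.
  exact: (continuous_comp (cw f) (continuous_ln (face_weight_gt0 x f))).
have c2 : {for x, continuous (fun y : T => \sum_(e in edges glue) Delta e * y e)}.
  by apply: (@continuous_bigsum T R) => e _; exact: continuous_scale_coord.
have c3 : {for x, continuous (fun y : T => pi * \sum_f ln (face_weight y f))}.
  exact: (continuous_comp c1 (@mulrl_continuous R pi _)).
exact: (continuousB c3 c2).
Qed.

(** Both terms change by [pi * #|F| * t], the second because the total of [Delta] is [pi * #|F|]. *)
Lemma scaling_potential_shift x y (t : R) :
  (forall e, e \in edges glue -> x e = y e + t) ->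
  scaling_potential x = scaling_potential y.
Proof.
move=> xy.
have wE f : face_weight x f = expR t * face_weight y f.
  rewrite /face_weight mulr_sumr; apply: eq_bigr => i _.
  by rewrite xy ?edge_of_in// expRD mulrC.
rewrite /scaling_potential.
under eq_bigr do rewrite wE lnM ?posrE ?expR_gt0 ?face_weight_gt0// expRK.
under [X in _ - X = _]eq_bigr => e eE do rewrite xy// mulrDr.
rewrite !big_split /= -mulr_suml (sum_Delta Delta_faces) sumr_const -mulr_natr; ring.
Qed.

Lemma scaling_potential_min (f0 : F) :
  exists x, forall y, scaling_potential x <= scaling_potential y.
Proof.
have [d d0 coer] := coercivity Delta_gt0 Delta_faces.
pose z : {set side F} -> R := fun=> 0.
have z0 : 0 <= scaling_potential z.
  rewrite /scaling_potential [X in _ - X]big1 => [|e _]; last by rewrite mulr0.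
  rewrite subr0 mulr_ge0 ?pi_ge0// sumr_ge0// => f _.
  exact: (ln_face_weight_ge z (f, ord0)).
(* Chosen so that a normalised point with a coordinate above [c] has, by coercivity, potential at
   least that of [z]. The minimum over the box [[0, c]] is then global. *)
set c := scaling_potential z / d.
have c0 : 0 <= c by rewrite divr_ge0// ltW.
have [x xb xmin] := box_argmin c0 continuous_scaling_potential.
exists x => y.
have e1E : edge_of glue (f0, ord0) \in edges glue by exact: edge_of_in.
have [e0 e0E e0min] := @arg_minP _ _ _ _ (mem (edges glue)) y e1E.
have {}e0E : e0 \in edges glue by exact: e0E.
(* Shift invariance normalises the least edge value to 0, as [coercivity] demands. *)
pose y1 e := if e \in edges glue then y e - y e0 else 0.
have -> : scaling_potential y = scaling_potential y1.
  by apply: (@scaling_potential_shift _ _ (y e0)) => e eE; rewrite /y1 eE subrK.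
have y1_ge0 e : 0 <= y1 e.
  by rewrite /y1; case: ifP => // eE; rewrite subr_ge0; exact: e0min.
have [/forallP yc|] := boolP [forall e, y1 e <= c].
  by apply: xmin => e; rewrite y1_ge0 yc.
rewrite negb_forall => /existsP[e]; rewrite -ltNge => ce.
have eE : e \in edges glue.
  by move: ce; rewrite /y1; case: ifP => // _; rewrite ltNge c0.
have := coer y1 (fun f => ln (face_weight y1 f)) (fun e _ => y1_ge0 e) _ (ln_face_weight_ge y1) e eE.
have ex0 : exists2 e0, e0 \in edges glue & y1 e0 = 0.
  by exists e0 => //; rewrite /y1 e0E subrr.
move=> /(_ ex0); apply: le_trans.
have xz : scaling_potential x <= scaling_potential z by apply: xmin => ?; rewrite lexx.
apply: le_trans xz _.
by rewrite -ler_pdivrMl// mulrC ltW.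
Qed.

Lemma angle_system_exists (f0 : F) : exists al, angle_system glue Delta al.
Proof.
have [x xmin] := scaling_potential_min f0.
pose w (s : side F) := expR (x (edge_of glue s)) / face_weight x s.1.
have w0 s : 0 < w s by rewrite divr_gt0// ?expR_gt0 ?face_weight_gt0.
have wf f : \sum_i w (f, i) = 1.
  by rewrite /w /= -mulr_suml mulfV// gt_eqF// face_weight_gt0.
exists (fun s => pi * w s); split.
- by move=> s; rewrite mulr_gt0 ?pi_gt0.
- by move=> f; rewrite -mulr_sumr wf mulr1.
move=> s0; set e := edge_of glue s0.
have eE : e \in edges glue by exact: edge_of_in.
(* Minimality is tested against raising the coordinate [e] alone by [t]; the bound [ln (1 + u) <= u]
   turns it into the inequality of [expR_tangent]. *)
apply: expR_tangent => t.
pose y e' := if e' == e then x e' + t else x e'.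
have wy f : face_weight y f =
    face_weight x f * (1 + (\sum_(i | edge_of glue (f, i) == e) w (f, i)) * (expR t - 1)).
  rewrite mulrDr mulr1 [X in _ + X]mulrA mulr_sumr mulr_suml [X in _ + X]big_mkcond.
  rewrite -big_split /=; apply: eq_bigr => i _; rewrite /y.
  have Z0 : face_weight x f != 0 by rewrite gt_eqF// face_weight_gt0.
  by case: ifP => _; rewrite ?addr0// expRD /w /=; field.
have lnwy f : ln (face_weight y f) <= ln (face_weight x f) +
    (\sum_(i | edge_of glue (f, i) == e) w (f, i)) * (expR t - 1).
  have := face_weight_gt0 y f; rewrite wy pmulr_rgt0 ?face_weight_gt0// => h.
  rewrite lnM ?posrE ?face_weight_gt0// lerD2l le_ln1Dx//; lra.
have := xmin y; rewrite /scaling_potential.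
have -> : \sum_(e in edges glue) Delta e * y e =
    \sum_(e in edges glue) Delta e * x e + Delta e * t.
  rewrite (bigD1 e)//= [in RHS](bigD1 e)//= {1}/y eqxx mulrDr.
  rewrite (eq_bigr (fun e => Delta e * x e)); first by ring.
  by move=> e' /andP[_ /negbTE ne]; rewrite /y ne.
have : \sum_f ln (face_weight y f) <= \sum_f (ln (face_weight x f) +
    (\sum_(i | edge_of glue (f, i) == e) w (f, i)) * (expR t - 1)).
  by apply: ler_sum => f _; exact: lnwy.
rewrite big_split /= -mulr_suml.
have -> : \sum_(r in e) pi * w r =
    pi * \sum_f \sum_(i | edge_of glue (f, i) == e) w (f, i).
  rewrite -mulr_sumr pair_big_dep /=; congr (_ * _).
  by apply: eq_big => [[f i]|[f i]]; rewrite /= ?(mem_edge_of Hglue).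
have := pi_gt0 R.
set W := \sum_f \sum_(i | _) _; set X := \sum_f _; set Y := \sum_f _.
nra.
Qed.

End Scaling.

(** * Representations as dual cochains *)

Section Holonomy.
Context {R : realType} {F : finType} (glue : side F -> option (side F)).
Hypothesis Hglue : is_gluing glue.
Variable b : F.

(** The walk back across the same edges. [pmap] drops boundary sides, which no actual walk
    crosses. *)
Definition rev_walk (w : seq (side F)) : seq (side F) := rev (pmap glue w).

Lemma rev_walk_cat u v : rev_walk (u ++ v) = rev_walk v ++ rev_walk u.
Proof. by rewrite /rev_walk pmap_cat rev_cat. Qed.

Lemma rev_walk_cons s t w :
  glue s = Some t -> rev_walk (s :: w) = rev_walk w ++ [:: t].
Proof. by move=> st; rewrite -cat1s rev_walk_cat /rev_walk /= st. Qed.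

Lemma walk_end_cat f u v :
  walk_end glue f (u ++ v) = obind (fun g => walk_end glue g v) (walk_end glue f u).
Proof.
elim: u f => //= s u IH f; case: eqP => // _.
by case: (glue s) => // t; exact: IH.
Qed.

Lemma walk_end_cons f g s w : walk_end glue f (s :: w) = Some g ->
  exists t, [/\ s.1 = f, glue s = Some t & walk_end glue t.1 w = Some g].
Proof. by move=> /=; case: eqP => // <-; case: (glue s) => // t h; exists t. Qed.

Lemma walk_glue f g w s :
  walk_end glue f w = Some g -> s \in w -> exists t, glue s = Some t.
Proof.
elim: w f => [//|r w IH] f /walk_end_cons[t [_ rt tw]].
by rewrite inE => /predU1P[->|/(IH _ tw)//]; exists t.
Qed.

Lemma walk_end_rev f g w :
  walk_end glue f w = Some g -> walk_end glue g (rev_walk w) = Some f.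
Proof.
elim: w f => [|s w IH] f; first by move=> [->].
move=> /walk_end_cons[t [sf st tw]].
by rewrite (rev_walk_cons _ st) walk_end_cat (IH _ tw)/= eqxx (Hglue st).1 sf.
Qed.

Lemma rev_walkK f g w : walk_end glue f w = Some g -> rev_walk (rev_walk w) = w.
Proof.
elim: w f => [//|s w IH] f /walk_end_cons[t [_ st tw]].
rewrite (rev_walk_cons _ st) rev_walk_cat (IH _ tw).
by rewrite (rev_walk_cons _ (Hglue st).1).
Qed.

Lemma connected_walk (Hconn : surface_connected glue) g :
  exists w, walk_end glue b w = Some g.
Proof.
have /connectP[p bp ->] := Hconn b g.
elim: p b bp => [|y p IH] x /=; first by exists [::].
move=> /andP[/existsP[i /existsP[j /eqP xy]] /IH[w yw]].
by exists ((x, i) :: w); rewrite /= eqxx xy.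
Qed.

Variable H : seq (side F) -> R.
Hypothesis Hrep : is_rep glue b H.

Lemma rep_nil : H [::] = 0.
Proof. by have := Hrep.1 [::] [::] erefl erefl; rewrite /=; lra. Qed.

(** A representation cancels one backtrack at a time: the inner part of the excursion goes first, by
    induction, and then its outermost pair. *)
Lemma rep_cancel u w v f g :
  walk_end glue b u = Some f -> walk_end glue f w = Some g ->
  walk_end glue f v = Some b ->
  H (u ++ w ++ rev_walk w ++ v) = H (u ++ v).
Proof.
elim: w u v f => [//|s w IH] u v f bu /walk_end_cons[t [sf st tw]] fv.
have ts := (Hglue st).1.
have -> : u ++ (s :: w) ++ rev_walk (s :: w) ++ v =
    (u ++ [:: s]) ++ w ++ rev_walk w ++ t :: v.
  by rewrite (rev_walk_cons _ st) -!catA.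
rewrite (IH _ _ t.1)//; first last.
- by rewrite /= eqxx ts sf.
- by rewrite walk_end_cat bu /= sf eqxx st.
rewrite -catA; apply: (Hrep.2 _ _ _ _ st).
by rewrite /closed_walk walk_end_cat bu /= sf eqxx st eqxx ts sf.
Qed.

(* [kappa] is half the holonomy of the loop that crosses [s] once and is
   otherwise confined to a fixed system of paths from [b]. *)
Lemma rep_cochain (Hconn : surface_connected glue) :
  exists kappa : side F -> R, forall w, closed_walk glue b w ->
    \sum_(s <- w) (kappa s - oapp kappa 0 (glue s)) = H w.
Proof.
have [p pP] := choice (connected_walk Hconn).
pose h s := if glue s is Some t then H (p s.1 ++ s :: rev_walk (p t.1)) else 0.
have closed_loop s t : glue s = Some t ->
    closed_walk glue b (p s.1 ++ s :: rev_walk (p t.1)).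
  move=> st; rewrite /closed_walk walk_end_cat pP /= eqxx st.
  exact: walk_end_rev.
have loop0 f : H (p f ++ rev_walk (p f)) = 0.
  have := @rep_cancel [::] (p f) [::] b f erefl (pP f) erefl.
  by rewrite /= cats0 rep_nil.
(* An excursion to [b] and back inserted at the face [f] splits a loop into two loops at [b]. *)
have cancel f u v : walk_end glue b u = Some f -> walk_end glue f v = Some b ->
    closed_walk glue b (u ++ rev_walk (p f)) ->
    H (u ++ rev_walk (p f)) + H (p f ++ v) = H (u ++ v).
  move=> bu fv cu; rewrite -(Hrep.1 _ _ cu); last first.
    by rewrite /closed_walk walk_end_cat pP.
  have := @rep_cancel u (rev_walk (p f)) v f b bu (walk_end_rev (pP f)) fv.
  by rewrite (rev_walkK (pP f)) -!catA.
have anti s t : glue s = Some t -> h t = - h s.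
  move=> st; have ts := (Hglue st).1; apply/eqP; rewrite -addr_eq0 addrC /h st ts.
  have bu : walk_end glue b (p s.1 ++ [:: s]) = Some t.1.
    by rewrite walk_end_cat pP /= eqxx st.
  have fv : walk_end glue t.1 (t :: rev_walk (p s.1)) = Some b.
    by rewrite /= eqxx ts; exact: walk_end_rev.
  have := cancel t.1 _ _ bu fv; rewrite -!catA !cat1s => ->; last exact: closed_loop.
  rewrite /= (Hrep.2 _ _ _ _ st) ?loop0//.
  rewrite /closed_walk walk_end_cat pP /= eqxx st eqxx ts; exact: walk_end_rev.
have main w f g : walk_end glue f w = Some g ->
    H (p f ++ w ++ rev_walk (p g)) = \sum_(s <- w) h s.
  elim: w f => [|s w IH] f; first by move=> [<-]; rewrite /= big_nil loop0.
  move=> /walk_end_cons[t [sf st tw]]; rewrite big_cons -(IH _ tw) {1}/h st sf.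
  have bu : walk_end glue b (p f ++ [:: s]) = Some t.1.
    by rewrite walk_end_cat pP /= sf eqxx st.
  have fv : walk_end glue t.1 (w ++ rev_walk (p g)) = Some b.
    by rewrite walk_end_cat tw; exact: walk_end_rev.
  have := cancel t.1 _ _ bu fv; rewrite -!catA !cat1s => ->//.
  by rewrite -sf; exact: closed_loop.
(* [h] changes sign across an edge, so the difference of its halves on the two sides is [h]
   itself. *)
exists (fun s => h s / 2) => w bw.
have -> : \sum_(s <- w) (h s / 2 - oapp (fun s => h s / 2) 0 (glue s)) = \sum_(s <- w) h s.
  apply: eq_big_seq => s /(walk_glue bw)[t st].
  by rewrite st /= (anti _ _ st); field.
rewrite -(main _ _ _ bw).
(* The chosen path [p b] may be nonempty, but conjugation by it does not affect a homomorphism into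
   an abelian group. *)
have cb : closed_walk glue b (p b) by exact: pP.
have cr : closed_walk glue b (rev_walk (p b)) by exact: walk_end_rev.
rewrite (Hrep.1 _ _ cb); last by rewrite /closed_walk walk_end_cat bw.
rewrite (Hrep.1 _ _ bw cr).
have := loop0 b; rewrite (Hrep.1 _ _ cb cr); lra.
Qed.

End Holonomy.

(** * Slope of the volume at the boundary of the simplex of angles *)

Section FaceEstimates.
Local Open Scope classical_set_scope.
Context {R : realType}.
Implicit Types (a d K : R).

Lemma sum_ord3_at (i : 'I_3) (f : 'I_3 -> R) :
  \sum_j f j = f i + f (ordS i) + f (ordS (ordS i)).
Proof. by rewrite sum_ord3; have [->|->|->] := ord3P i; rewrite ?ordS3; ring. Qed.

Lemma line_cvg a d : (fun t : R => a + t * d) t @[t --> 0^'+] --> a.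
Proof.
apply: cvg_within_filter.
have : (fun t : R => a + t * d) t @[t --> (0 : R)] --> a + 0 * d.
  by apply: cvgD; [exact: cvg_cst|apply: cvgMl; exact: cvg_id].
by rewrite mul0r addr0.
Qed.

Lemma near_ln_sin_zero d K : 0 < d ->
  \forall t \near (0 : R)^'+, K <= - (d * ln (sin (0 + t * d))).
Proof.
move=> d0.
have lim0 := @line_cvg 0 d.
have slim : sin (0 + t * d) @[t --> 0^'+] --> (0 : R).
  rewrite -[X in _ --> X]sin0.
  exact: (continuous_cvg _ (@continuous_sin R 0) lim0).
have e0 : 0 < expR (- K / d) by exact: expR_gt0.
near=> t.
have t0 : 0 < t by [].
have tpi : 0 + t * d < pi by near: t; apply: (cvgr_lt _ lim0); exact: pi_gt0.
have st : sin (0 + t * d) < expR (- K / d) by near: t; exact: (cvgr_lt _ slim).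
have s0 : 0 < sin (0 + t * d) by rewrite sin_gt0_pi// tpi add0r mulr_gt0.
have : ln (sin (0 + t * d)) <= - K / d.
  by rewrite -[leRHS]expRK ler_ln ?posrE// ltW.
rewrite ler_pdivlMr//; lra.
Unshelve. all: by end_near. Qed.

Lemma near_ln_sin_interior a d : 0 < a < pi ->
  exists C, \forall t \near (0 : R)^'+, C <= - (d * ln (sin (a + t * d))).
Proof.
move=> api; exists (- (d * ln (sin a)) - 1).
have s0 := sin_gt0_pi api.
have h : - (d * ln (sin (a + t * d))) @[t --> 0^'+] --> - (d * ln (sin a)).
  apply: cvgN; apply: cvgMr.
  apply: (continuous_cvg _ (continuous_ln s0)).
  exact: (continuous_cvg _ (@continuous_sin R a) (@line_cvg a d)).
near=> t; apply: ltW; near: t; apply: (cvgr_gt _ h); lra.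
Unshelve. all: by end_near. Qed.

(** The derivative of [\sum_i A (a i + t * d i)] in [t], where [A' = - ln sin]: the contribution of
    one face to the slope of the volume without its linear term. *)
Definition face_slope (a d : 'I_3 -> R) (t : R) : R :=
  \sum_i - (d i * ln (sin (a i + t * d i))).

Section OneFace.
Variables a al : 'I_3 -> R.
Hypotheses (a0 : forall i, 0 <= a i) (asum : \sum_i a i = pi).
Hypotheses (al0 : forall i, 0 < al i) (alsum : \sum_i al i = pi).
Let d i := al i - a i.

(** At a zero angle the increment is positive and the term tends to [+oo]; at an interior angle it
    converges. Only an angle [pi], with its negative increment, could send it to [-oo]. *)
Lemma near_term_lower i : a i != pi ->
  exists C, \forall t \near (0 : R)^'+, C <= - (d i * ln (sin (a i + t * d i))).
Proof.
move=> api; have [ai0|ain0] := eqVneq (a i) 0.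
  by exists 0; rewrite ai0; apply: near_ln_sin_zero; rewrite /d ai0 subr0.
apply: near_ln_sin_interior; rewrite lt_def ain0 a0 /= lt_neqAle api /=.
by have := asum; rewrite (sum_ord3_at i); have := a0 (ordS i); have := a0 (ordS (ordS i)); lra.
Qed.

(* For the degenerate angles [(pi, 0, 0)] the infinite slopes cancel: with
   increments [x, y > 0] of the zero angles, the slope is
   [x ln (sin t(x+y) / sin tx) + y ln (sin t(x+y) / sin ty) >= 0]. *)
Lemma face_slope_degenerate p : a p = pi ->
  \forall t \near (0 : R)^'+, 0 <= face_slope a d t.
Proof.
move=> ap.
have := asum; rewrite (sum_ord3_at p) ap => s.
have ax : a (ordS p) = 0 by have := a0 (ordS p); have := a0 (ordS (ordS p)); lra.
have ay : a (ordS (ordS p)) = 0 by lra.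
have := alsum; rewrite (sum_ord3_at p) => s'.
have lim0 := @line_cvg 0 pi.
near=> t.
have t0 : 0 < t by [].
have t2 : 0 + t * pi < pi / 2.
  by near: t; apply: (cvgr_lt _ lim0); rewrite divr_gt0 ?pi_gt0.
rewrite /face_slope (sum_ord3_at p) /d ap ax ay !subr0.
set x := al (ordS p) in s' *; set y := al (ordS (ordS p)) in s' *.
have x0 : 0 < x by exact: al0.
have y0 : 0 < y by exact: al0.
have p0 := al0 p.
have -> : al p - pi = - (x + y) by lra.
have -> : sin (pi + t * - (x + y)) = sin (t * (x + y)).
  by rewrite addrC sinDpi mulrN sinN opprK.
rewrite !add0r in t2 *.
have tx : 0 < t * x by rewrite mulr_gt0.
have ty : 0 < t * y by rewrite mulr_gt0.
have txy : t * (x + y) < pi / 2 by apply: le_lt_trans t2; rewrite ler_pM2l//; lra.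
have txyE : t * (x + y) = t * x + t * y by ring.
have pp := pi_gt0 R.
have lx : ln (sin (t * x)) <= ln (sin (t * (x + y))).
  rewrite ler_ln ?posrE ?sin_gt0_pi//; try by apply/andP; split; lra.
  by rewrite ltW// ltr_sin ?in_itv /=; try (apply/andP; split); lra.
have ly : ln (sin (t * y)) <= ln (sin (t * (x + y))).
  rewrite ler_ln ?posrE ?sin_gt0_pi//; try by apply/andP; split; lra.
  by rewrite ltW// ltr_sin ?in_itv /=; try (apply/andP; split); lra.
nra.
Unshelve. all: by end_near. Qed.

Lemma face_slope_lower :
  exists C, \forall t \near (0 : R)^'+, C <= face_slope a d t.
Proof.
have [/forallP np|] := boolP [forall i, a i != pi]; last first.
  by rewrite negb_forall => /existsP[p /negPn/eqP/face_slope_degenerate]; exists 0.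
have [C hC] := choice (fun i => near_term_lower (np i)).
exists (\sum_i C i); near=> t; apply: ler_sum => i _.
by move: i; near: t; exact: filter_forall.
Unshelve. all: by end_near. Qed.

Lemma face_slope_infty K : (forall i, a i != pi) -> (exists i, a i = 0) ->
  \forall t \near (0 : R)^'+, K <= face_slope a d t.
Proof.
move=> np [i ai].
have [C1 h1] := near_term_lower (np (ordS i)).
have [C2 h2] := near_term_lower (np (ordS (ordS i))).
have di : 0 < d i by rewrite /d ai subr0.
have h0 := near_ln_sin_zero (K - C1 - C2) di.
near=> t; rewrite /face_slope (sum_ord3_at i).
have e0 : K - C1 - C2 <= - (d i * ln (sin (a i + t * d i))).
  by rewrite ai; near: t.
have e1 : C1 <= - (d (ordS i) * ln (sin (a (ordS i) + t * d (ordS i)))) by near: t.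
have e2 : C2 <= - (d (ordS (ordS i)) * ln (sin (a (ordS (ordS i)) + t * d (ordS (ordS i))))).
  by near: t.
lra.
Unshelve. all: by end_near. Qed.

End OneFace.

End FaceEstimates.

(** * Maximising the volume *)

Lemma is_derive_bigsum (R : realType) (J : Type) (r : seq J) (P : pred J)
    (h : J -> R -> R) (dh : J -> R) (x : R) :
  (forall j, P j -> is_derive x 1 (h j) (dh j)) ->
  is_derive x 1 (fun y => \sum_(j <- r | P j) h j y) (\sum_(j <- r | P j) dh j).
Proof.
move=> dP; elim: r => [|j r IH].
  rewrite big_nil (_ : (fun _ => _) = cst 0); first exact: is_derive_cst.
  by apply/funext => y; rewrite big_nil.
rewrite big_cons; case: (boolP (P j)) => Pj.
  rewrite (_ : (fun _ => _) = (h j \+ (fun y => \sum_(j <- r | P j) h j y))).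
    by have dj := dP j Pj; exact: is_deriveD.
  by apply/funext => y; rewrite big_cons Pj.
rewrite (_ : (fun _ => _) = (fun y => \sum_(j <- r | P j) h j y)) //.
by apply/funext => y; rewrite big_cons (negbTE Pj).
Qed.

Section Variational.
Context {R : realType} {F : finType} (glue : side F -> option (side F)).
Hypothesis Hglue : is_gluing glue.
Variables (Delta : {set side F} -> R) (kappa : side F -> R) (beta : side F -> R).
Hypothesis Delta_le : forall e, e \in edges glue -> Delta e <= pi.
Hypothesis beta_sys : angle_system glue Delta beta.

Definition feasible (x : side F -> R) :=
  (forall f, \sum_i x (f, i) = pi) /\
  (forall s, \sum_(r in edge_of glue s) x r = Delta (edge_of glue s)).

Lemma face_angle_lt_pi (x : side F -> R) s :
  (forall s, 0 < x s) -> \sum_i x (s.1, i) = pi -> x s < pi.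
Proof.
case: s => f i x0 /=; rewrite (sum_ord3_at i).
have := x0 (f, ordS i); have := x0 (f, ordS (ordS i)); lra.
Qed.

(* The angle [pi] of a degenerate face lies opposite an edge with [Delta = pi],
   so the other side of that edge is a zero angle, again in a degenerate face.
   For the system [beta], the [k] such edges would absorb the whole angle sum
   [k pi] of the [k] degenerate faces, although they only use [2k] of their [3k]
   angles. *)
Lemma no_degenerate_faces (x : side F -> R) :
  feasible x -> (forall s, 0 <= x s) ->
  (forall s, x s = 0 -> exists i, x (s.1, i) = pi) ->
  forall s, 0 < x s.
Proof.
move=> [xf xe] x0 xdeg; have [b0 bf be] := beta_sys.
pose X : {set side F} := [set s | x s == pi].
suff X0 : X = finset.set0.
  move=> s; rewrite lt_def x0 andbT; apply/eqP => /xdeg[i xi].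
  by have : (s.1, i) \in X; [rewrite inE xi|rewrite X0 inE].
have piX s : s \in X -> x s = pi by rewrite inE => /eqP.
have two s : s \in X -> forall r, r.1 = s.1 -> r != s -> x r = 0.
  move=> /piX; case: s => f i /= xs [g j] /= -> ji.
  have := xf f; rewrite (sum_ord3_at i) xs.
  have := x0 (f, ordS i); have := x0 (f, ordS (ordS i)) => h1 h2 h3.
  have [z1 z2] : x (f, ordS i) = 0 /\ x (f, ordS (ordS i)) = 0 by split; lra.
  have : [\/ j = i, j = ordS i | j = ordS (ordS i)].
    have [] := ord3P i => ->; have [] := ord3P j => ->; rewrite ?ordS3;
      by [constructor 1|constructor 2|constructor 3].
  by case=> jE; rewrite jE // in ji *; rewrite eqxx in ji.
have glueX s : s \in X -> exists2 t, glue s = Some t & x t = 0 /\ beta s + beta t = pi.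
  move=> sX; have := xe s; have := be s; rewrite !sum_edge// piX//.
  case: (glue s) => [t|] h1 h2.
    exists t => //; have := x0 t; have := Delta_le (edge_of_in glue s); split; lra.
  (* On a boundary edge [beta s] alone would equal [pi], impossible beside two other positive
     angles. *)
  by have := face_angle_lt_pi b0 (bf s.1); lra.
pose g s := odflt s (glue s).
have gX s : s \in X -> [/\ glue s = Some (g s), x (g s) = 0 & beta s + beta (g s) = pi].
  by move=> /glueX[t st [xt bst]]; rewrite /g st.
have ginj : {in X &, injective g}.
  move=> s r /gX[gs _ _] /gX[gr _ _] e.
  by have := (Hglue gs).1; rewrite e (Hglue gr).1 => -[].
have finj : {in X &, injective (fun s : side F => s.1)}.
  move=> s r sX rX /= e; apply/eqP/negPn/negP => sr.
  by have := pi_gt0 R; rewrite -(piX _ sX) (two _ rX _ e sr) ltxx.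
pose Y := [set g s | s in X].
pose D := [set s.1 | s in X].
pose SD : {set side F} := [set s | s.1 \in D].
have cY : #|Y| = #|X| by exact: card_in_imset.
have cD : #|D| = #|X| by exact: card_in_imset.
have cSD : #|SD| = (#|X| * 3)%N.
  rewrite -cD -[X in (_ * X)%N]card_ord -cardsT -cardsX; congr #|pred_of_set _|.
  by apply/setP => -[f i]; rewrite !inE andbT.
have XSD : X \subset SD.
  by apply/fintype.subsetP => s sX; rewrite inE; apply: imset_f.
have YSD : Y \subset SD.
  apply/fintype.subsetP => t /imsetP[s /gX[_ xt _] ->].
  have [i xi] := xdeg _ xt; rewrite inE; apply/imsetP; exists ((g s).1, i) => //.
  by rewrite inE xi.
have XY : [disjoint X & Y].
  rewrite -setI_eq0; apply/eqP/setP => t; rewrite !inE.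
  apply/negP => /andP[/eqP tp /imsetP[s /gX[_ xt _] ts]].
  by have := pi_gt0 R; rewrite -tp ts xt ltxx.
have XYSD : X :|: Y \subset SD by rewrite finset.subUset XSD.
have sXY : \sum_(s in X :|: Y) beta s = pi * #|X|%:R.
  rewrite (eq_bigl [predU X & Y]) => [|s]; last by rewrite !inE.
  rewrite bigU//= /Y big_imset//= -big_split /= (eq_bigr (fun=> pi)) => [|s /gX[]//].
  by rewrite sumr_const mulr_natr.
have sSD : \sum_(s in SD) beta s = pi * #|X|%:R.
  rewrite -cD (eq_bigl (fun s : side F => s.1 \in D)) => [|s]; last by rewrite inE.
  by rewrite sum_sides (eq_bigr (fun=> pi)) => [|f _]; rewrite ?sumr_const ?mulr_natr.
have rest : \sum_(s in SD :\: (X :|: Y)) beta s = 0.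
  move: sSD; rewrite (big_setID (X :|: Y)) (finset.setIidPr XYSD) /= sXY; lra.
have SDE : SD \subset X :|: Y.
  rewrite -finset.setD_eq0; apply/eqP/setP => s; rewrite [RHS]inE; apply/negP => sin.
  have : beta s = 0 by apply: (psumr_eq0P _ rest) => // r _; exact: ltW.
  by have := b0 s => /[swap] ->; rewrite ltxx.
have := subset_leq_card SDE; rewrite cSD.
move/leq_trans/(_ (leq_card_setU X Y)); rewrite cY => h.
apply/eqP; rewrite -cards_eq0; move: h.
by rewrite mulnS muln2 -addnn -[X in (_ <= X)%N]add0n leq_add2r leqn0.
Qed.

Variable A : R -> R.
Hypothesis A_cont : forall y, 0 <= y <= pi -> {for y, continuous A}.
Hypothesis A_der : forall y, 0 < y < pi -> is_derive y 1 A (- ln (sin y)).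

(** On feasible points in the box the [A] part is, up to an additive constant, the total volume of
    ideal hyperbolic tetrahedra with these angles. The linear part prescribes the holonomy. *)
Definition volume (x : side F -> R) : R := \sum_s (A (x s) + kappa s * x s).

Definition slope (x v : side F -> R) : R :=
  \sum_s v s * (- ln (sin (x s)) + kappa s).

Let line (x v : side F -> R) (t : R) : side F -> R := fun s => x s + t * v s.

Lemma is_derive_volume x v (t : R) : (forall s, 0 < line x v t s < pi) ->
  is_derive t 1 (fun t => volume (line x v t)) (slope (line x v t) v).
Proof.
move=> xpi; apply: is_derive_bigsum => s _.
have dl : is_derive t 1 (fun t => x s + t * v s) (v s).
  by apply: is_derive_eq; rewrite scaler0 !add0r mul1r [LHS]mulr1.
have dA := @is_derive1_comp _ A (fun t => x s + t * v s) t _ _ (A_der (xpi s)) dl.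
have dA' : is_derive t 1 (fun t => A (x s + t * v s)) _ := dA.
rewrite /line; apply: is_derive_eq; rewrite [_ *: _]mulrC; ring.
Qed.

Lemma continuous_volume (x : side F -> R) : (forall s, 0 <= x s <= pi) ->
  {for x, continuous (volume : prod_topology (fun _ : side F => R) -> R)}.
Proof.
pose T := prod_topology (fun _ : side F => R) : topologicalType.
move=> xpi; apply: (@continuous_bigsum T R) => s _.
have c1 : {for x, continuous (fun y : T => A (y s))}.
  exact: (continuous_comp (@continuous_coord R _ s x) (A_cont (xpi s))).
exact: (continuousD c1 (@continuous_scale_coord R _ (kappa s) s x)).
Qed.

Lemma continuous_volume_line x v (t : R) : (forall s, 0 <= line x v t s <= pi) ->
  {for t, continuous (fun t : R => volume (line x v t))}.
Proof.
move=> xpi; apply: (@continuous_bigsum _ R) => s _.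
have c1 : {for t, continuous (fun t : R => x s + t * v s)}.
  by apply: cvgD; [exact: cvg_cst|apply: cvgMl; exact: cvg_id].
have c2 : {for t, continuous (fun t : R => A (x s + t * v s))}.
  exact: (continuous_comp c1 (A_cont (xpi s))).
have c3 : {for t, continuous (fun t : R => kappa s * (x s + t * v s))}.
  exact: (continuous_comp c1 (@mulrl_continuous R (kappa s) _)).
exact: (continuousD c2 c3).
Qed.

Lemma volume_max : exists x, [/\ feasible x, forall s, 0 <= x s <= pi &
  forall y, feasible y -> (forall s, 0 <= y s <= pi) -> volume y <= volume x].
Proof.
(* Feasibility as one linear system, with an equation for each face and each side, in the form of
   [closed_linear_eq]. *)
pose a (j : F + side F) (s : side F) : R :=
  match j with inl f => (s.1 == f)%:R | inr r => (s \in edge_of glue r)%:R end.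
pose d (j : F + side F) : R :=
  match j with inl f => pi | inr r => Delta (edge_of glue r) end.
have lin (P : pred (side F)) (x : side F -> R) :
    \sum_s (P s)%:R * x s = \sum_(s | P s) x s.
  by rewrite [RHS]big_mkcond; apply: eq_bigr => s _; case: (P s); rewrite ?mul1r ?mul0r.
have lin_face (x : side F -> R) f : \sum_(s : side F | s.1 == f) x s = \sum_i x (f, i).
  rewrite (eq_bigl (fun s : side F => s.1 \in [set f]%SET)) => [|s]; last by rewrite inE.
  by rewrite sum_sides big_set1.
have feasE x : (forall j, \sum_s a j s * x s = d j) <-> feasible x.
  split=> [h|[h1 h2] [f|r] /=].
  - by split=> [f|r]; [have := h (inl f)|have := h (inr r)];
      rewrite /a/= lin ?lin_face.
  - by rewrite lin lin_face.
  - by rewrite lin.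
have [b0 bf be] := beta_sys.
have [||x [Px bx] xmax] := @box_argmax R (side F) pi _ volume
    (@closed_linear_eq R (side F) (F + side F)%type a d).
- by move=> x _; exact: continuous_volume.
- exists beta; first exact/feasE.
  by move=> s; rewrite (ltW (b0 s)) ltW// face_angle_lt_pi.
exists x; split => //; first exact/feasE.
by move=> y /feasE; exact: xmax.
Qed.

Lemma feasible_lt_pi x : feasible x -> (forall s, 0 < x s) ->
  forall s, 0 < x s < pi.
Proof. by move=> [xf _] x0 s; rewrite x0 face_angle_lt_pi. Qed.

Lemma volume_max_gt0 x : feasible x -> (forall s, 0 <= x s <= pi) ->
  (forall y, feasible y -> (forall s, 0 <= y s <= pi) -> volume y <= volume x) ->
  forall s, 0 < x s.
Proof.
move=> xfeas xb xmax.
have x0 s : 0 <= x s by have /andP[] := xb s.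
have [xf xe] := xfeas; have [b0 bf be] := beta_sys.
(* It remains to exclude a zero angle in a face without an angle [pi]; such a face makes the slope
   towards [beta] infinite. *)
apply: no_degenerate_faces => // s0 xs0.
apply: contrapT => nopi.
have np i : x (s0.1, i) != pi by apply/eqP => xi; apply: nopi; exists i.
pose v s := beta s - x s.
pose fs f t := face_slope (fun i => x (f, i)) (fun i => v (f, i)) t.
have [C hC] := choice (fun f => face_slope_lower
  (fun i => x0 (f, i)) (xf f) (fun i => b0 (f, i)) (bf f)).
(* With this [K] the face of [s0] outweighs the linear part and the lower bounds of all other faces,
   leaving a slope of at least 1. *)
pose K := 1 - \sum_s v s * kappa s - \sum_(f | f != s0.1) C f.
have ez : exists i, x (s0.1, i) = 0 by exists s0.2; rewrite -surjective_pairing.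
have hK : \forall t \near at_right (0 : R), K <= fs s0.1 t.
  exact: (face_slope_infty (fun i => x0 (s0.1, i)) (xf s0.1)
    (fun i => b0 (s0.1, i)) K np ez).
have slope_gt0 : \forall t \near at_right (0 : R), 0 < slope (line x v t) v.
  near=> t.
  have -> : slope (line x v t) v = \sum_s v s * kappa s + \sum_f fs f t.
    rewrite /slope (eq_bigr (fun s => v s * kappa s - v s * ln (sin (x s + t * v s)))).
      rewrite big_split /=; congr (_ + _).
      rewrite /fs /face_slope pair_big /=.
      by apply: eq_bigr => -[].
    by move=> s _; rewrite /line; ring.
  rewrite (bigD1 s0.1)//=.
  have h1 : K <= fs s0.1 t by near: t.
  have h2 : \sum_(f | f != s0.1) C f <= \sum_(f | f != s0.1) fs f t.
    by apply: ler_sum => f _; move: f; near: t; exact: filter_forall.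
  by rewrite /K in h1; lra.
have [e e0 he] : exists2 e, 0 < e < 1 & forall t, 0 < t < e -> 0 < slope (line x v t) v.
  move: slope_gt0 => [e /= e0 he]; exists (Num.min e (1 / 2)).
    by rewrite lt_min e0 /= gt_min; apply/andP; split; lra.
  move=> t /andP[t0]; rewrite lt_min => /andP[te _]; apply: he => //=.
  by rewrite sub0r normrN gtr0_norm.
have lineE t s : line x v t s = (1 - t) * x s + t * beta s by rewrite /line /v; ring.
have line_itv t : 0 < t < 1 -> forall s, 0 < line x v t s < pi.
  move=> /andP[t0 t1] s; rewrite lineE.
  have := x0 s; have /andP[_] := xb s; have := b0 s.
  have := face_angle_lt_pi b0 (bf s.1) => h1 h2 h3 h4.
  apply/andP; split; nra.
have line0 : line x v 0 = x by apply/funext => s; rewrite /line mul0r addr0.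
have line_feas t : feasible (line x v t).
  split=> [f|s].
    by under eq_bigr do rewrite lineE; rewrite big_split -!mulr_sumr /= xf bf; ring.
  by under eq_bigr do rewrite lineE; rewrite big_split -!mulr_sumr /= xe be; ring.
pose T := prod_topology (fun _ : side F => R) : topologicalType.
pose c := e / 2.
have c0 : 0 < c < e by rewrite /c; apply/andP; split; lra.
(* At [t = 0] only continuity is available, since [ln sin] is unbounded there. The mean value
   theorem still shows that the volume increases strictly along the segment, against maximality. *)
have [|||z] := @MVT R (fun t => volume (line x v t)) (fun t => slope (line x v t) v) 0 c.
- lra.
- move=> t; rewrite in_itv /= => /andP[t0 tc]; apply: is_derive_volume.
  by apply: line_itv; lra.
- apply: continuous_in_subspaceT => t /set_mem; rewrite /= in_itv /= => /andP[t0 tc].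
  apply: continuous_volume_line => s; have [->|tn0] := eqVneq t 0; first by rewrite line0.
  have tpos : 0 < t by rewrite lt_def tn0.
  have t1 : 0 < t < 1 by rewrite tpos; lra.
  by have /andP[h1 h2] := line_itv t t1 s; rewrite !ltW.
rewrite in_itv /= => /andP[z0 zc]; rewrite line0 subr0 => hz.
have : volume (line x v c) <= volume x.
  have c1 : 0 < c < 1 by lra.
  apply: xmax => // s; have /andP[h1 h2] := line_itv c c1 s.
  by rewrite !ltW.
have : 0 < slope (line x v z) v * c.
  by rewrite mulr_gt0 ?he//; lra.
lra.
Unshelve. all: by end_near. Qed.

Lemma volume_max_stationary x v : feasible x -> (forall s, 0 < x s) ->
  (forall y, feasible y -> (forall s, 0 <= y s <= pi) -> volume y <= volume x) ->
  (forall f, \sum_i v (f, i) = 0) ->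
  (forall s, \sum_(r in edge_of glue s) v r = 0) ->
  slope x v = 0.
Proof.
move=> xfeas x0 xmax vf ve.
have xpi := feasible_lt_pi xfeas x0; have [xf xe] := xfeas.
(* For [|t| < d] every angle moves by less than its distance to 0 and to [pi]; the added 1 avoids
   division by zero. *)
have [|d d0 hd] := @finite_lower_bound R _ predT
    (fun s => Num.min (x s) (pi - x s) / (1 + `|v s|)).
  move=> s _; have /andP[h1 h2] := xpi s.
  by rewrite divr_gt0// ?lt_min ?h1 ?subr_gt0// ltr_pwDl.
have line_itv t : -d < t < d -> forall s, 0 < line x v t s < pi.
  move=> td s; have := hd s isT.
  have n0 : 0 < 1 + `|v s| by rewrite ltr_pwDl.
  rewrite ler_pdivlMr// le_min => /andP[h1 h2].
  have : `|t * v s| < d * (1 + `|v s|).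
    rewrite normrM; apply: (@le_lt_trans _ _ (`|t| * (1 + `|v s|))).
      by rewrite ler_wpM2l// lerDr.
    by rewrite ltr_pM2r// ltr_norml.
  by rewrite ltr_norml /line => /andP[h3 h4]; apply/andP; split; lra.
have line_feas t : feasible (line x v t).
  split=> [f|s]; rewrite /line big_split -mulr_sumr /= ?xf ?vf ?xe ?ve mulr0 addr0//.
have line0 : line x v 0 = x by apply/funext => s; rewrite /line mul0r addr0.
have D t : -d < t < d -> is_derive t 1 (fun t => volume (line x v t)) (slope (line x v t) v).
  by move=> td; apply: is_derive_volume; exact: line_itv.
have z0 : -d < (0 : R) < d by lra.
have d00 : is_derive (0 : R) 1 (fun t => volume (line x v t)) 0.
  apply: (@derive1_at_max _ _ (-d) d); rewrite ?in_itv //=; first lra.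
    by move=> t; rewrite in_itv /= => td; have [] := D t td.
  move=> t; rewrite in_itv /= => td; rewrite line0; apply: xmax => // s.
  by have /andP[h1 h2] := line_itv t td s; rewrite !ltW.
have := @derive_val _ _ _ _ _ _ _ d00.
by rewrite (@derive_val _ _ _ _ _ _ _ (D 0 z0)) line0.
Qed.

End Variational.

(** * From angle systems to similarity structures *)

Section Walks.
Context {R : realType} {F : finType} (glue : side F -> option (side F)).
Hypothesis Hglue : is_gluing glue.

(** The variation of angles attached to a walk: stationarity of the volume in this direction is the
    holonomy condition for [w]. *)
Definition crossings (w : seq (side F)) (r : side F) : R :=
  \sum_(s <- w) ((r == s)%:R - (Some r == glue s)%:R).

Lemma sum_crossings w (c : side F -> R) :
  \sum_r crossings w r * c r = \sum_(s <- w) (c s - oapp c 0 (glue s)).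
Proof.
under eq_bigr do rewrite /crossings mulr_suml.
rewrite exchange_big /=; apply: eq_bigr => s _.
under eq_bigr do rewrite mulrBl.
rewrite sumrB; congr (_ - _).
  rewrite (bigD1 s)//= eqxx mul1r big1 ?addr0// => r /negbTE ->.
  by rewrite mul0r.
case: (glue s) => [t|] /=; last by rewrite big1// => r _; rewrite mul0r.
rewrite (bigD1 t)//= eqxx mul1r big1 ?addr0// => r rt.
by rewrite (inj_eq Some_inj) (negbTE rt) mul0r.
Qed.

Lemma sum_crossings_set w (P : pred (side F)) :
  \sum_(r | P r) crossings w r =
  \sum_(s <- w) ((P s)%:R - oapp (fun t => (P t)%:R) 0 (glue s)).
Proof.
rewrite -(sum_crossings w (fun s => (P s)%:R)) [LHS]big_mkcond.
by apply: eq_bigr => r _; case: (P r); rewrite ?mulr1 ?mulr0.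
Qed.

(** Each crossing leaves one face and enters the next, so the sum telescopes; for a closed walk it
    vanishes. *)
Lemma crossings_face w f g h : walk_end glue f w = Some g ->
  \sum_i crossings w (h, i) = (f == h)%:R - (g == h)%:R.
Proof.
have -> : \sum_i crossings w (h, i) = \sum_(s : side F | s.1 \in [set h]%SET) crossings w s.
  by rewrite sum_sides big_set1.
rewrite sum_crossings_set.
elim: w f => [|s w IH] f; first by move=> [->]; rewrite big_nil subrr.
move=> /walk_end_cons[t [sf st tw]].
by rewrite big_cons (IH _ tw) st /= !inE sf; ring.
Qed.

(** The two sides of a crossing lie in the same edge, where their contributions cancel. *)
Lemma crossings_edge w f g s0 : walk_end glue f w = Some g ->
  \sum_(r in edge_of glue s0) crossings w r = 0.
Proof.
rewrite sum_crossings_set.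
elim: w f => [|s w IH] f; first by rewrite big_nil.
move=> /walk_end_cons[t [sf st tw]].
rewrite big_cons (IH _ tw) st /= !(mem_edge_of Hglue) (edge_of_glue Hglue st).
by rewrite subrr addr0.
Qed.

Lemma angle_system_of_triangles (Delta : {set side F} -> R) tri :
  triangles_ok tri ->
  (forall s, Delta (edge_of glue s) = dihedral glue tri s) ->
  angle_system glue Delta (opp_angle tri).
Proof.
move=> ok D.
have cr f i : 0 < cross (vsub (tri f i) (tri f (ordS (ordS i))))
                        (vsub (tri f (ordS i)) (tri f (ordS (ordS i)))).
  have := ok f.
  by have [->|->|->] := ord3P i; rewrite ?ordS3 /cross /vsub /=; lra.
split.
- by case=> f i; rewrite /opp_angle /=; have [_ /andP[]] := angle_at_cos_sin (cr f i).
- move=> f; rewrite sum_ord3 /opp_angle /= !ordS3.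
  have := angle_sum (cr f ord0); lra.
- by move=> s; rewrite sum_edge// D /dihedral.
Qed.

Lemma triangles_of_angle_system (Delta : {set side F} -> R) al :
  angle_system glue Delta al ->
  exists tri : F -> 'I_3 -> pt R,
    [/\ triangles_ok tri, forall s, dihedral glue tri s = Delta (edge_of glue s) &
        forall s, side_len tri s = sin (al s)].
Proof.
move=> [al0 alf ale].
have [tri triP] := choice (fun f =>
  @triangle_of_angles R (fun i => al (f, i)) (fun i => al0 (f, i)) (alf f)).
have opp s : opp_angle tri s = al s.
  by case: s => f i; have [_ + _] := triP f; exact.
exists tri; split.
- by move=> f; have [] := triP f.
- move=> s; rewrite -ale sum_edge// /dihedral.
  by case: (glue s) => [t|]; rewrite !opp.
- by case=> f i; have [_ _] := triP f; exact.
Qed.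

End Walks.

Theorem theorem3p1 (R : realType) (F : finType)
  (glue : side F -> option (side F))
  (Hglue : is_gluing glue) (Hconn : surface_connected glue)
  (Delta : {set side F} -> R)
  (HDelta : forall e, e \in edges glue -> 0 < Delta e <= pi)
  (b : F) (Hd : seq (side F) -> R) (Hrep : is_rep glue b Hd) :
  (exists tri : F -> 'I_3 -> pt R,
      [/\ triangles_ok tri,
          has_dil_holonomy glue tri b Hd,
          is_delaunay glue tri
        & forall s : side F, Delta (edge_of glue s) = dihedral glue tri s])
  <->
  ((forall e, e \in edges glue -> 0 < Delta e) /\
   (forall Fs : {set F},
      pi * #|Fs|%:R <= \sum_(e in face_edges glue Fs) Delta e /\
      (\sum_(e in face_edges glue Fs) Delta e = pi * #|Fs|%:R <->
         Fs = [set: F]%SET \/ face_edges glue Fs = finset.set0))).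
Proof.
split=> [[tri [ok _ _ D]]|[D0 Dfaces]].
  split=> [e /HDelta/andP[]//|Fs].
  exact: (angle_system_face_bound Hglue Fs Hconn (angle_system_of_triangles Hglue ok D)).
have Dpi e : e \in edges glue -> Delta e <= pi by move=> /HDelta/andP[].
have [beta beta_sys] := angle_system_exists Hglue D0 Dfaces b.
have [kappa kappaP] := rep_cochain Hglue Hrep Hconn.
have [A [A_cont A_der]] := ln_sin_primitive R.
have [al [al_feas al_box al_max]] := volume_max kappa beta_sys A_cont.
have al0 := volume_max_gt0 Hglue Dpi beta_sys A_cont A_der al_feas al_box al_max.
have al_sys : angle_system glue Delta al by case: al_feas.
have [tri [ok dih len]] := triangles_of_angle_system Hglue al_sys.
exists tri; split => //.
  move=> w bw; rewrite -kappaP//.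
  have vf f : \sum_i crossings glue w (f, i) = 0 :> R.
    by rewrite (crossings_face f bw) subrr.
  have := volume_max_stationary A_der al_feas al0 al_max vf
    (fun s0 => crossings_edge Hglue s0 bw).
  (* Stationarity says that [kappa s - ln (sin (al s))] has zero total jump along [w]. As side
     lengths are these sines, the jumps of [ln sin] are the log-dilatations. *)
  rewrite /slope sum_crossings => st0; apply/eqP; rewrite -subr_eq0 -oppr_eq0; apply/eqP.
  rewrite -[RHS]st0 /dil_hol -sumrB -sumrN; apply: eq_big_seq => s sw.
  have [t st] := walk_glue bw sw.
  have sin0 r : 0 < sin (al r).
    by rewrite sin_gt0_pi// al0 face_angle_lt_pi//; case: al_feas.
  by rewrite /log_dil st /= !len ln_div ?posrE//; ring.
by move=> s t st; rewrite dih; apply: Dpi; exact: edge_of_in.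
Qed.
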